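(* Let $n\geqslant 1$ and $k\in(0,1)$. Assume that $u_0=0$ and that $u_1\in\mathcal{C}^1_0(\mathbb{R}^n)$ is a nonnegative function with support contained in $B_R$ for some $R>0$. Consider an exponent $p$ in the nonlinearity of derivative type such that $$1<p\leqslant p_{\mathrm{Gla}}\big((1-k)n+2k\big).$$ Then there exists $\varepsilon_0=\varepsilon_0(n,p,k,u_1,R)>0$ such that for any $\varepsilon\in(0,\varepsilon_0]$ the following holds. If $u\in\mathcal{C}^2([1,T)\times\mathbb{R}^n)$ is a local in time solution to the Cauchy problem $$\begin{cases} \partial_t^2u-t^{-2k}\Delta u=|\partial_t u|^p, & x\in \mathbb{R}^n, \ t>1,\\ u(1,x)=\varepsilon u_0(x), & x\in \mathbb{R}^n, \\ \partial_t u(1,x)=\varepsilon u_1(x), & x\in \mathbb{R}^n,\end{cases}$$ such that $\operatorname{supp} u(t,\cdot)\subset B_{R+A_k(t)}$ for any $t\in[1,T)$, and with lifespan $T=T(\varepsilon)$, then $u$ blows up in finite time, that is, $T<\infty$. Furthermore, the following upper bound estimate for the lifespan holds: $$T(\varepsilon)\leqslant \begin{cases} C\,\varepsilon^{-\left(\frac{1}{p-1}-\frac{(1-k)n+2k-1}{2}\right)^{-1}} & \text{if } 1<p<p_{\mathrm{Gla}}\big((1-k)n+2k\big),\\ \exp\big(C\varepsilon^{-(p-1)}\big) & \text{if } p=p_{\mathrm{Gla}}\big((1-k)n+2k\big),\end{cases}$$ where the positive constant $C$ is independent of $\varepsilon$.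
   Context: Notation. $n$ is the (integer) space dimension, and $B_r=\{x\in\mathbb{R}^n:|x|<r\}$. $\mathcal{C}^j_0(\mathbb{R}^n)$ denotes the $\mathcal{C}^j$ functions with compact support. The function $\phi_k(t)=\frac{t^{1-k}}{1-k}$ is the primitive of $t^{-k}$ vanishing at $t=0$, and $A_k(t)=\phi_k(t)-\phi_k(1)=\int_1^t\tau^{-k}\,\mathrm{d}\tau$. The Glassey exponent, evaluated at a real argument $m\geqslant 1$, is $p_{\mathrm{Gla}}(m)=\frac{m+1}{m-1}$ if $m>1$ and $p_{\mathrm{Gla}}(1)=\infty$. The constant $\varepsilon>0$ describes the size of the Cauchy data. The lifespan $T=T(\varepsilon)$ is the maximal existence time of the local in time solution $u$.
   Formalization: The function u_1 is additionally assumed not to be identically zero: for u_1 = 0 the function u = 0 is a global solution satisfying every hypothesis with T = ∞, so the claim as written fails in that case. *)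

(* Defs.v *)
From HB Require Import structures.
From mathcomp Require Import all_boot all_order all_algebra.
From mathcomp Require Import all_classical all_reals all_analysis.
Set Implicit Arguments.
Unset Strict Implicit.
Unset Printing Implicit Defensive.
Import Order.TTheory GRing.Theory Num.Theory.
Import numFieldNormedType.Exports.
Local Open Scope classical_set_scope.
Local Open Scope ring_scope.

(* The library norm on 'rV[R]_n is the sup norm (same topology), so the
   Euclidean norm has to be introduced separately. *)
Definition enorm (R : realType) (n : nat) (x : 'rV[R]_n) : R :=
  Num.sqrt (\sum_(i < n) x 0 i ^+ 2).

Definition eball (R : realType) (n : nat) (r : R) : set 'rV[R]_n :=
  [set x | enorm x < r].

Definition supp (R : realType) (V : normedModType R) (f : V -> R) : set V :=
  closure [set x | f x != 0].

(* f is of class C^j on D, for D contained in the closure of its interior: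
   f is continuous on D and its directional derivatives, which exist in the
   interior of D, extend to functions g of class C^(j-1) on D. For
   D = [1, T[ x R^n this is the usual C^j regularity up to t = 1; for D = setT
   it is C^j on the whole space. *)
Fixpoint Cj_on (R : realType) (V : normedModType R) (j : nat) (D : set V)
    (f : V -> R) : Prop :=
  {within D, continuous f} /\
  match j with
  | 0%N => True
  | i.+1 => forall v : V, exists g : V -> R,
      Cj_on i D g /\ (forall z, interior D z -> is_derive z v f (g z))
  end.

Definition Cj_compact (R : realType) (n j : nat) (f : 'rV[R]_n -> R) : Prop :=
  Cj_on j setT f /\ compact (supp f).

Definition phi (R : realType) (k t : R) : R := t `^ (1 - k) / (1 - k).

Definition A (R : realType) (k t : R) : R := phi k t - phi k 1.

(* Only meaningful for 1 <= m. *)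
Definition pGla (R : realType) (m : R) : \bar R :=
  if 1 < m then ((m + 1) / (m - 1))%:E else +oo%E.

(* Space-time functions take a pair z = (t, x). *)
Definition strip (R : realType) (n : nat) (T : \bar R) : set (R * 'rV[R]_n) :=
  [set z | 1 <= z.1 /\ (z.1%:E < T)%E].

Definition dt (R : realType) (n : nat) (u : R * 'rV[R]_n -> R) :
    R * 'rV[R]_n -> R :=
  fun z => 'D_((1 : R), (0 : 'rV[R]_n)) u z.

Definition dx (R : realType) (n : nat) (i : 'I_n) (u : R * 'rV[R]_n -> R) :
    R * 'rV[R]_n -> R :=
  fun z => 'D_((0 : R), (delta_mx 0 i : 'rV[R]_n)) u z.

Definition laplacian (R : realType) (n : nat) (u : R * 'rV[R]_n -> R) :
    R * 'rV[R]_n -> R :=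
  fun z => \sum_(i < n) dx i (dx i u) z.

(* u is a C^2 solution on [1, T[ x R^n of
     u_tt - t^(-2k) Laplacian u = |u_t|^p,   u(1, .) = f,   u_t(1, .) = g.
   Values of u outside [1, T[ x R^n are irrelevant; in particular u_t(1, x) is
   the one-sided derivative. *)
Record local_solution (R : realType) (n : nat) (k p : R) (f g : 'rV[R]_n -> R)
    (T : \bar R) (u : R * 'rV[R]_n -> R) : Prop := {
  sol_time : (1%:E < T)%E ;
  sol_C2 : Cj_on 2 (strip T) u ;
  sol_eq : forall (t : R) (x : 'rV[R]_n), 1 < t -> (t%:E < T)%E ->
    dt (dt u) (t, x) - t `^ (- (2 * k)) * laplacian u (t, x)
      = `|dt u (t, x)| `^ p ;
  sol_init : forall x : 'rV[R]_n, u (1, x) = f x ;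
  sol_init_dt : forall x : 'rV[R]_n,
    (fun h : R => h^-1 * (u (1 + h, x) - u (1, x))) @ 0^'+ --> g x
}.

(* T is the maximal existence time of the local solution u. *)
Definition has_lifespan (R : realType) (n : nat) (k p : R)
    (f g : 'rV[R]_n -> R) (T : \bar R) (u : R * 'rV[R]_n -> R) : Prop :=
  local_solution k p f g T u /\
  forall (T' : \bar R) (v : R * 'rV[R]_n -> R),
    (T < T')%E -> local_solution k p f g T' v ->
    ~ (forall z, strip T z -> v z = u z).

(* Main.v *)
Require Import Defs.
From HB Require Import structures.
From mathcomp Require Import all_boot all_order all_algebra.
From mathcomp Require Import all_classical all_reals all_analysis.
From mathcomp Require Import ring lra.
Import Order.TTheory GRing.Theory Num.Theory.
Import numFieldNormedType.Exports.
Local Open Scope classical_set_scope.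
Local Open Scope ring_scope.
Set Implicit Arguments.
Unset Strict Implicit.
Unset Printing Implicit Defensive.

(** The argument is a reduction to an ordinary differential inequality.  Test
    the equation against the weight exp(x_0), an eigenfunction of the Laplacian
    with eigenvalue 1, and put U(t) = integral of u(t,x) exp(x_0) dx.  Since u
    has compact support at each time, integrating by parts gives
      U'' = t^(-2k) U + N,   N(t) = integral of |u_t|^p exp(x_0) dx,
    with U(1) = 0 and U'(1) = eps * (integral of u_1 exp(x_0)) > 0.

    Two facts about this equation produce blow-up.

    The first is a lower bound of N by a power of V = U'.  By Jensen's
    inequality N >= V^p M^(1-p), where M(t) bounds the integral of the weight
    over the ball of radius rho = r + A_k(t), that is over the forward light
    cone.  On that ball x_0 <= rho - |x'|^2 / (2 rho), where x' collects the
    other coordinates, so the weight is concentrated near the tip of the ball,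
    in a region of width of order 1 in the direction x_0 and of order rho^(1/2)
    in the others: M is of order e^rho rho^((n-1)/2), hence at most of order
    e^(A_k(t)) t^((1-k)(n-1)/2).  See [le_prod_expR_lorentz] and
    [moment_power_ge].

    The second is a comparison with the linear equation U'' = t^(-2k) U, whose
    growing solution behaves like t^(k/2) e^(A_k(t)).  The quantities
    D = V - t^(-k) U and Y = V + t^(-k) U diagonalize its principal part; D
    stays nonnegative, so V >= Y/2, and W = t^(k/2) e^(-A_k) Y satisfies
      W' >= c W^p t^(-a),  a = (p-1)((1-k)n + 2k - 1)/2,
    because the exponentials in V^p M^(1-p) combine to a single e^(A_k).
    Integrating -(W^(1-p))' / (p-1) >= c t^(-a) bounds the integral of t^(-a)
    up to any time of existence by a multiple of eps^(1-p); this is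
    [ode_bound].  The Glassey condition on p says that a <= 1.  If a < 1 the
    integral grows like t^(1-a) and if a = 1 like log t, which gives the two
    lifespan estimates.

    Integrals over R^n are realized as iterated integrals over a cube that
    contains the support of u up to the time considered ([int_list]).  The
    integrations are made on functions of (t, x), one coordinate at a time, so
    that differentiation in the remaining variables commutes with each of them. *)

(** * Integrals of continuous functions over a symmetric segment *)

Definition int1 {R : realType} (L : R) (f : R -> R) : R :=
  \int[lebesgue_measure]_(s in `[- L, L]) f s.

Lemma lorentz_continuous {R : realType} (c a : R) :
  continuous (fun y : R => (1 + ((y - c) / a) ^+ 2)^-1).
Proof.
move=> y; apply: cvgV; first by rewrite gt_eqF// ltr_pwDl// sqr_ge0.
apply: cvgD; first exact: cvg_cst.
apply: (@cvg_comp _ _ _ (fun s => (s - c) / a) (fun y => y ^+ 2)); last first.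
  exact: exprn_continuous.
by apply: cvgMl; apply: cvgB; [exact: cvg_id|exact: cvg_cst].
Qed.

Section OneVariable.
Context {R : realType} (L : R) (L0 : 0 < L).
Implicit Types f g F : R -> R.

Let LL : - L < L.
Proof. by rewrite gtrN. Qed.

Lemma integrable_int1 f a b : continuous f ->
  (@lebesgue_measure R).-integrable `[a, b] (EFin \o f).
Proof.
move=> cf; apply: continuous_compact_integrable; first exact: segment_compact.
exact: continuous_subspaceT.
Qed.

Lemma int1D f g : continuous f -> continuous g ->
  int1 L (fun s => f s + g s) = int1 L f + int1 L g.
Proof. by move=> cf cg; apply: RintegralD => //; exact: integrable_int1. Qed.

Lemma int1B f g : continuous f -> continuous g ->
  int1 L (fun s => f s - g s) = int1 L f - int1 L g.
Proof. by move=> cf cg; apply: RintegralB => //; exact: integrable_int1. Qed.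

Lemma int1Z a f : continuous f -> int1 L (fun s => a * f s) = a * int1 L f.
Proof. by move=> cf; apply: RintegralZl => //; exact: integrable_int1. Qed.

Lemma eq_int1 f g : (forall s, s \in `[- L, L] -> f s = g s) ->
  int1 L f = int1 L g.
Proof. by move=> fg; apply: eq_Rintegral => s; rewrite inE => /fg. Qed.

Lemma int1_cst a : int1 L (fun=> a) = a * (2 * L).
Proof.
rewrite /int1 Rintegral_cst//= lebesgue_measure_itv/= lte_fin LL.
by rewrite -EFinD/= opprK mulrDl mul1r.
Qed.

Lemma le_int1 f g : continuous f -> continuous g ->
  (forall s, s \in `[- L, L] -> f s <= g s) -> int1 L f <= int1 L g.
Proof.
move=> cf cg fg; apply: le_Rintegral => //; try exact: integrable_int1.
Qed.

Lemma int1_ge0 f : (forall s, s \in `[- L, L] -> 0 <= f s) -> 0 <= int1 L f.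
Proof. by move=> f0; apply: Rintegral_ge0. Qed.

Lemma le_abs_int1 f a : continuous f ->
  (forall s, s \in `[- L, L] -> `|f s| <= a) -> `|int1 L f| <= a * (2 * L).
Proof.
move=> cf fa; rewrite -int1_cst.
have c0 : continuous (fun _ : R => a) by move=> x; exact: cvg_cst.
have c1 : continuous (fun _ : R => - a) by move=> x; exact: cvg_cst.
rewrite ler_norml; apply/andP; split.
  rewrite int1_cst -mulNr -int1_cst; apply: le_int1 => // s /fa.
  by rewrite ler_norml => /andP[].
by apply: le_int1 => // s /fa; rewrite ler_norml => /andP[].
Qed.

Lemma int1_FTC f F : continuous f -> (forall s : R, is_derive s 1 F (f s)) ->
  int1 L f = F L - F (- L).
Proof.
move=> cf dF.
have cF : continuous F.
  by move=> x; apply/differentiable_continuous/derivable1_diffP.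
rewrite /int1 /Rintegral (@continuous_FTC2 _ f F (- L) L) //=.
- exact: continuous_subspaceT.
- split; [by move=> s _ | | ].
  + by apply: cvg_at_right_filter; exact: cF.
  + by apply: cvg_at_left_filter; exact: cF.
- by move=> s _; rewrite derive1E derive_val.
Qed.

Lemma subset_Rintegral f a b c d : continuous f ->
  (forall s, s \in `[a, b] -> 0 <= f s) -> a <= c -> d <= b ->
  \int[lebesgue_measure]_(s in `[c, d]) f s <=
  \int[lebesgue_measure]_(s in `[a, b]) f s.
Proof.
move=> cf f0 ac db; have sub : `[c, d] `<=` `[a, b].
  by apply: subset_itv; rewrite bnd_simp.
apply: fine_le; try by apply: integrable_fin_num => //; exact: integrable_int1.
apply: ge0_subset_integral => //.
by apply: measurable_int; exact: integrable_int1.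
Qed.

Lemma int1_gt0 f a : continuous f -> (forall s, s \in `[- L, L] -> 0 <= f s) ->
  a \in `]- L, L[ -> 0 < f a -> 0 < int1 L f.
Proof.
move=> cf f0 aL fa.
have : \forall d \near 0^'+, forall s, `|a - s| <= d -> f a / 2 <= f s.
  have : \forall s \near a, f a / 2 <= f s.
    have : \forall s \near a, `|f a - f s| < f a / 2.
      by have /cvgrPdist_lt/(_ (f a / 2)) := cf a; apply; rewrite divr_gt0.
    apply: filterS => s; rewrite ltr_norml => /andP[_]; lra.
  move=> /nbhs_ballP[e /= e0 he]; near=> d.
  have de : d < e by near: d; exact: nbhs_right_lt.
  by move=> s asd; apply: he; rewrite /ball/= (le_lt_trans asd).
move=> hd; near (0 : R)^'+ => d.
have d0 : 0 < d by [].
have hd1 : forall s, `|a - s| <= d -> f a / 2 <= f s by near: d.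
have hdL : d < L - a by near: d; apply: nbhs_right_lt; rewrite subr_gt0 (itvP aL).
have hdL' : d < a + L.
  by near: d; apply: nbhs_right_lt; move: aL; rewrite in_itv/= => /andP[]; lra.
have c0 : continuous (fun _ : R => f a / 2) by move=> x; exact: cvg_cst.
apply: (@lt_le_trans _ _ (f a / 2 * (2 * d))); first by rewrite mulr_gt0//; lra.
apply: le_trans (@subset_Rintegral f (- L) L (a - d) (a + d) _ _ _ _) => //;
  try lra.
have -> : f a / 2 * (2 * d) = \int[lebesgue_measure]_(s in `[a - d, a + d]) (f a / 2).
  rewrite Rintegral_cst//= lebesgue_measure_itv/= lte_fin ifT; last lra.
  by rewrite -EFinD/=; congr (_ * _); lra.
apply: le_Rintegral => //; try exact: integrable_int1.
move=> s /=; rewrite in_itv/= => /andP[h1 h2]; apply: hd1.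
by rewrite ler_norml; apply/andP; split; lra.
Unshelve. all: by end_near. Qed.

Lemma le_int1_widen f L' : continuous f -> (forall s, 0 <= f s) -> L <= L' ->
  int1 L f <= int1 L' f.
Proof.
by move=> cf f0 LL'; apply: subset_Rintegral => //; rewrite lerN2.
Qed.

(** The profiles with which exp(x_0) will be majorized: their primitive is an
    arctangent, so the bound is explicit and uniform in the size of the cube. *)
Lemma int1_lorentz c a : 0 < a ->
  int1 L (fun s => (1 + ((s - c) / a) ^+ 2)^-1) <= pi * a.
Proof.
move=> a0.
have cf := @lorentz_continuous R c a.
have dF (s : R) : is_derive s 1 (fun s => a * atan ((s - c) / a))
    (1 + ((s - c) / a) ^+ 2)^-1.
  have h : is_derive s 1 (fun s : R => (s - c) / a) (a^-1).
    rewrite (_ : (fun s : R => (s - c) / a) = (a^-1 \*: (id - cst c))); last first.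
      by apply/funext => x /=; rewrite mulrC.
    by apply: is_derive_eq; rewrite subr0 /GRing.scale /= mulr1.
  rewrite (_ : (fun s : R => a * atan _) = a \*: (atan \o (fun s => (s - c) / a)));
    last by apply/funext.
  by apply: is_derive_eq; rewrite /GRing.scale/= mulrCA mulfV ?gt_eqF// mulr1.
have -> := int1_FTC cf dF.
have := atan_ltpi2 ((L - c) / a); have := atan_gtNpi2 ((- L - c) / a).
move=> h1 h2; rewrite -mulrBr [leRHS]mulrC; apply: ler_wpM2l; [exact: ltW|lra].
Qed.
End OneVariable.

(** * Rules for continuity and directional derivatives *)

Section ContinuityRules.
Context {X : topologicalType}.

Lemma cont_comp {Y Z : topologicalType} (f : X -> Y) (g : Y -> Z) :
  continuous f -> continuous g -> continuous (fun x => g (f x)).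
Proof. by move=> cf cg x; apply: (@cvg_comp _ _ _ f g); [exact: cf|exact: cg]. Qed.

Lemma cont_pair {Y Z : topologicalType} (f : X -> Y) (g : X -> Z) :
  continuous f -> continuous g -> continuous (fun x => (f x, g x)).
Proof. by move=> cf cg x; apply: cvg_pair; [exact: cf|exact: cg]. Qed.

Lemma cont_fst {Y Z : topologicalType} (f : X -> Y * Z) :
  continuous f -> continuous (fun x => (f x).1).
Proof. by move=> cf; apply: cont_comp => // -[y z]; exact: cvg_fst. Qed.

Lemma cont_snd {Y Z : topologicalType} (f : X -> Y * Z) :
  continuous f -> continuous (fun x => (f x).2).
Proof. by move=> cf; apply: cont_comp => // -[y z]; exact: cvg_snd. Qed.

Lemma cont_id : continuous (fun x : X => x).
Proof. by move=> x; exact: cvg_id. Qed.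

Lemma cont_cst {Y : topologicalType} (y : Y) : continuous (fun _ : X => y).
Proof. by move=> x; exact: cvg_cst. Qed.

Context {R : realType} {V : normedModType R}.

Lemma cont_add (f g : X -> V) :
  continuous f -> continuous g -> continuous (fun x => f x + g x).
Proof. by move=> cf cg x; apply: cvgD; [exact: cf|exact: cg]. Qed.

Lemma cont_sub (f g : X -> V) :
  continuous f -> continuous g -> continuous (fun x => f x - g x).
Proof. by move=> cf cg x; apply: cvgB; [exact: cf|exact: cg]. Qed.

Lemma cont_scale (f : X -> R) (g : X -> V) :
  continuous f -> continuous g -> continuous (fun x => f x *: g x).
Proof. by move=> cf cg x; apply: cvgZ; [exact: cf|exact: cg]. Qed.

Lemma cont_norm (f : X -> V) :
  continuous f -> continuous (fun x => `|f x|).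
Proof. by move=> cf x; apply: cvg_norm; exact: cf. Qed.

Lemma cont_mul (f g : X -> R) :
  continuous f -> continuous g -> continuous (fun x => f x * g x).
Proof. by move=> cf cg x; apply: cvgM; [exact: cf|exact: cg]. Qed.

End ContinuityRules.

Lemma cont_prod {X : topologicalType} {R : realType} {I : Type} (r : seq I)
    (P : pred I) (f : I -> X -> R) :
  (forall i, continuous (f i)) -> continuous (fun x => \prod_(i <- r | P i) f i x).
Proof.
move=> cf; elim: r => [|i r IH].
  rewrite (_ : (fun x => _) = fun=> 1); first exact: cont_cst.
  by apply/funext => x; rewrite big_nil.
rewrite (_ : (fun x => _) = (fun x => (if P i then f i x else 1) *
    \prod_(j <- r | P j) f j x)); last first.
  by apply/funext => x; rewrite big_cons; case: ifP => // _; rewrite mul1r.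
by apply: cont_mul => //; case: (P i) => //; exact: cont_cst.
Qed.

Lemma cont_sum {X : topologicalType} {R : realType} {I : Type} (r : seq I)
    (F : I -> X -> R) :
  (forall i, continuous (F i)) -> continuous (fun x => \sum_(i <- r) F i x).
Proof.
move=> cF; elim: r => [|i r IH].
  rewrite (_ : (fun x => _) = (fun=> 0)); first exact: cont_cst.
  by apply/funext => x; rewrite big_nil.
rewrite (_ : (fun x => _) = (fun x => F i x + \sum_(j <- r) F j x)).
  exact: cont_add.
by apply/funext => x; rewrite big_cons.
Qed.

(** Composing with a map that takes its values in D turns continuity relative to
    D into plain continuity: this removes the boundary t = 1 of the domain. *)
Lemma cont_comp_within {X Y Z : topologicalType} (D : set Y) (c : X -> Y) (f : Y -> Z) :
  continuous c -> (forall x, D (c x)) -> {within D, continuous f} ->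
  continuous (fun x => f (c x)).
Proof.
move=> cc Dc /subspace_continuousP cf x U Uf.
have cU : nbhs x (c @^-1` [set y | D y -> U (f y)]).
  exact: (cc x _ (cf _ (Dc x) U Uf)).
have sub : c @^-1` [set y | D y -> U (f y)] `<=` (fun x => f (c x)) @^-1` U.
  by move=> y /=; apply; exact: Dc.
exact: (filterS sub cU).
Qed.

Section DerivativeRules.
Context {R : realType} {V : normedModType R}.
Implicit Types (f g : V -> R) (x v : V) (a b : R).

Lemma is_derive_fun_add f g x v a b : is_derive x v f a -> is_derive x v g b ->
  is_derive x v (fun y => f y + g y) (a + b).
Proof. by move=> df dg; exact: is_deriveD. Qed.

Lemma is_derive_fun_sub f g x v a b : is_derive x v f a -> is_derive x v g b ->
  is_derive x v (fun y => f y - g y) (a - b).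
Proof. by move=> df dg; exact: is_deriveB. Qed.

Lemma is_derive_fun_mul f g x v a b : is_derive x v f a -> is_derive x v g b ->
  is_derive x v (fun y => f y * g y) (f x * b + g x * a).
Proof. by move=> df dg; exact: is_deriveM. Qed.

Lemma der_val f x v a b : is_derive x v f a -> a = b -> is_derive x v f b.
Proof. by move=> df <-. Qed.

Lemma is_derive_fun_cst x v a : is_derive x v (fun _ : V => a) 0.
Proof. exact: is_derive_cst. Qed.

End DerivativeRules.

Lemma der_comp {R : realType} (f g : R -> R) (x a b : R) :
  is_derive x 1 g a -> is_derive (g x) 1 f b ->
  is_derive x 1 (fun y => f (g y)) (b * a).
Proof. by move=> dg df; exact: is_derive1_comp. Qed.

Lemma der_continuous {R : realType} (f : R -> R) (x a : R) :
  is_derive x 1 f a -> {for x, continuous f}.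
Proof. by move=> df; apply/differentiable_continuous/derivable1_diffP. Qed.

(** Differentiability is required only inside the interval, since the solution
    has no two-sided time derivative at t = 1. *)
Lemma der_ge0_le {R : realType} (f df : R -> R) (a b : R) : a <= b ->
  (forall x, a <= x <= b -> {for x, continuous f}) ->
  (forall x, a < x < b -> is_derive x 1 f (df x)) ->
  (forall x, a < x < b -> 0 <= df x) -> f a <= f b.
Proof.
move=> ab cf dfx df0; rewrite -subr_ge0.
have [ab'|ba] := ltP a b; last first.
  have -> : b = a by apply/le_anti; rewrite ab ba.
  by rewrite subrr.
have dfx' x : x \in `]a, b[ -> is_derive x 1 f (df x).
  by rewrite in_itv; exact: dfx.
have cf' : {within `[a, b], continuous f}.
  by apply: continuous_in_subspaceT => x /[!inE] /=; rewrite in_itv/=; exact: cf.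
have [c cab ->] := MVT ab' dfx' cf'.
by rewrite mulr_ge0 ?subr_ge0// df0//; rewrite in_itv in cab.
Qed.

(** Directional derivatives on a space of several variables and derivatives of
    one variable have the same difference quotients along a line; this lemma and
    the next one translate in each direction. *)
Lemma is_derive_line {R : realType} {V : normedModType R} (f : V -> R)
    (c : R -> V) (v : V) (d s : R) :
  (forall h, c (h + s) = h *: v + c s) -> is_derive (c s) v f d ->
  is_derive s 1 (f \o c) d.
Proof.
move=> cE [df <-].
have E : (fun h : R => h^-1 *: ((((f \o c) \o shift s) (h *: (1 : R))) - (f \o c) s)) =
    (fun h => h^-1 *: ((f \o shift (c s)) (h *: v) - f (c s))).
  by apply/funext => h /=; rewrite /GRing.scale/= mulr1 cE.
by apply: DeriveDef; rewrite /derivable /derive E.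
Qed.

Lemma is_derive_along {R : realType} {V : normedModType R} (f : V -> R) (z v : V) (d : R) :
  is_derive (0 : R) 1 (fun h : R => f (h *: v + z)) d -> is_derive z v f d.
Proof.
move=> [df <-].
have E : (fun h : R => h^-1 *: ((f \o shift z) (h *: v) - f z)) =
  (fun h : R => h^-1 *: (((fun h => f (h *: v + z)) \o shift 0) (h *: (1 : R)) -
     (fun h => f (h *: v + z)) 0)).
  apply/funext => h /=; rewrite scale0r add0r addr0.
  by have -> : h *: (1 : R) = h by rewrite /GRing.scale/= mulr1.
by apply: DeriveDef; rewrite /derivable /derive E.
Qed.

Lemma der_near0 {R : realType} (f : R -> R) (t d : R) :
  (\forall s \near t, f s = 0) -> is_derive t 1 f d -> d = 0.
Proof.
move=> f0 [_ <-]; rewrite (near_eq_derive _ (g := cst 0) f0).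
by rewrite derive_cst.
Qed.

(** The form of the mean value theorem for increments h of either sign. *)
Lemma MVT_sym {R : realType} (k dk : R -> R) (h : R) :
  (forall s : R, `|s| <= `|h| -> is_derive s 1 k (dk s)) ->
  exists2 c, `|c| <= `|h| & k h - k 0 = dk c * h.
Proof.
move=> dkh.
have cont (I : set R) : (forall s, I s -> `|s| <= `|h|) -> {within I, continuous k}.
  move=> Ih; apply: continuous_in_subspaceT => x /[!inE] /Ih /dkh dx.
  exact/differentiable_continuous/derivable1_diffP.
have [h0|/ltW h0] := leP 0 h.
  have Ih s : s \in `[0, h] -> `|s| <= `|h|.
    by rewrite in_itv/= => /andP[s0 sh]; rewrite !ger0_norm.
  have [||c /Ih ch] := @MVT_segment _ k dk 0 h h0.
  - by move=> s sh; apply/dkh/Ih; exact: subset_itv_oo_cc.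
  - by apply: cont => s; exact: Ih.
  - by rewrite subr0 => E; exists c.
have Ih s : s \in `[h, 0] -> `|s| <= `|h|.
  by rewrite in_itv/= => /andP[sh s0]; rewrite !ler0_norm// lerN2.
have [||c /Ih ch] := @MVT_segment _ k dk h 0 h0.
- by move=> s sh; apply/dkh/Ih; exact: subset_itv_oo_cc.
- by apply: cont => s; exact: Ih.
- by rewrite sub0r mulrN => E; exists c => //; lra.
Qed.

(** A one-sided derivative equals the limit of the derivatives from inside.  It
    identifies the continuous extension of u_t at t = 1 with the initial
    velocity. *)
Lemma right_derivative_limit {R : realType} (f df : R -> R) (b l : R) : 0 < b ->
  continuous f -> continuous df ->
  (forall s : R, 0 < s < b -> is_derive s 1 f (df s)) ->
  h^-1 * (f h - f 0) @[h --> 0^'+] --> l -> df 0 = l.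
Proof.
move=> b0 cf cdf fd fl; apply: (@cvg_unique _ (@norm_hausdorff _ R) (h^-1 * (f h - f 0) @[h --> 0^'+])) => //.
apply/cvgrPdist_lt => e e0.
have /cvgrPdist_lt/(_ e e0) := cdf 0.
move=> /nbhs_ballP[d /= d0 Hd].
near=> h.
have hb : h < b by near: h; exact: nbhs_right_lt.
have hd : h < d by near: h; exact: nbhs_right_lt.
have h0 : 0 < h by [].
have dfh x : x \in `]0, h[ -> is_derive x 1 f (df x).
  by rewrite in_itv/= => /andP[x0 xh]; apply: fd; rewrite x0 (lt_trans xh).
have [c] := MVT h0 dfh (continuous_subspaceT cf).
rewrite in_itv/= subr0 => /andP[c0 ch] ->.
rewrite mulrCA mulVf ?gt_eqF// mulr1; apply: Hd.
by rewrite /ball/= sub0r normrN gtr0_norm// (lt_trans ch).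
Unshelve. all: by end_near. Qed.

(** * Iterated integrals over a cube *)

Section Slices.
Context {R : realType} {n : nat}.
Local Notation E := (R * 'rV[R]_n)%type.
Implicit Types (z v : E) (i j : 'I_n) (f g : E -> R).

Definition axis i : E := (0, delta_mx 0 i).

(** The i-th space coordinate of z is replaced by s.  The affine formula makes
    continuity and the behaviour on lines immediate. *)
Definition upd i z (s : R) : E := (z.1, z.2 + (s - z.2 0 i) *: delta_mx 0 i).

Lemma upd_coord i z s j : (upd i z s).2 0 j = if j == i then s else z.2 0 j.
Proof.
by rewrite /upd/= !mxE eqxx/=; case: eqP => [->|_] /=; rewrite ?mulr1 ?mulr0; lra.
Qed.

Lemma upd_id i z : upd i z (z.2 0 i) = z.
Proof. by rewrite /upd subrr scale0r addr0; case: z. Qed.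

Lemma upd_shift i z v (h s : R) : v.2 0 i = 0 ->
  upd i (h *: v + z) s = h *: v + upd i z s.
Proof.
by move=> vi; rewrite /upd/= !mxE vi mulr0 add0r; congr (_, _) => /=; rewrite addrA.
Qed.

Lemma upd_axis i z (h s : R) : upd i z (h + s) = h *: axis i + upd i z s.
Proof.
rewrite /upd/=; congr (_, _) => /=; first by rewrite scaler0 add0r.
by rewrite -(addrA h) scalerDl addrCA.
Qed.

Lemma coord_cont i : continuous (fun z : E => z.2 0 i).
Proof.
apply: (@cont_comp _ _ _ (fun z : E => z.2) (fun M : 'rV[R]_n => M 0 i)).
  exact/cont_snd/cont_id.
exact: coord_continuous.
Qed.

Lemma cont_upd {X : topologicalType} i (c : X -> E) (s : X -> R) :
  continuous c -> continuous s -> continuous (fun x => upd i (c x) (s x)).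
Proof.
move=> cc cs; apply: cont_pair; first exact: cont_fst.
apply: cont_add; first exact: cont_snd.
apply: cont_scale; last exact: cont_cst.
by apply: cont_sub => //; exact: (cont_comp cc (@coord_cont i)).
Qed.

Lemma cont_slice i f z : continuous f -> continuous (fun s => f (upd i z s)).
Proof.
by move=> cf; apply: (cont_comp _ cf); apply: cont_upd; [exact: cont_cst|exact: cont_id].
Qed.

(** Continuity is uniform along the compact segment; this is what lets limits
    and derivatives pass under the integral sign. *)
Lemma slice_near i f z (L e : R) : continuous f -> 0 < e ->
  \forall w \near z, forall s, s \in `[- L, L] -> `|f (upd i w s) - f (upd i z s)| < e.
Proof.
move=> cf e0.
have /compact_near_coveringP ccL := @segment_compact R (- L) L.
have := ccL E (nbhs z) (fun w s => `|f (upd i w s) - f (upd i z s)| < e).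
apply => s _.
have cF : continuous (fun sw : R * E => `|f (upd i sw.2 sw.1) - f (upd i z sw.1)|).
  apply: cont_norm; apply: cont_sub; apply: (cont_comp _ cf); apply: cont_upd.
  - exact/cont_snd/cont_id.
  - exact/cont_fst/cont_id.
  - exact: cont_cst.
  - exact/cont_fst/cont_id.
have h0 : `|f (upd i z s) - f (upd i z s)| < e by rewrite subrr normr0.
exact: (cvgr_lt _ (cF (s, z)) _ h0).
Qed.

Variables (L : R) (L0 : 0 < L).

Definition int_along i f z : R := int1 L (fun s => f (upd i z s)).

Lemma cont_int_along i f : continuous f -> continuous (int_along i f).
Proof.
move=> cf z; apply/cvgrPdist_le => e e0.
have e20 : 0 < e / (2 * L) by rewrite divr_gt0// mulr_gt0.
apply: filterS (slice_near i z L cf e20) => w hw.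
rewrite /int_along -int1B//; try exact: cont_slice.
rewrite (_ : e = e / (2 * L) * (2 * L)); last by rewrite divfK// gt_eqF// mulr_gt0.
apply: le_abs_int1 => //; first by apply: cont_sub; exact: cont_slice.
by move=> s /hw /ltW; rewrite distrC.
Qed.

(** By the mean value theorem each difference quotient of f is a value of g at a
    nearby point of the same slice, so its distance to g is small uniformly on
    the slice. *)
Lemma is_derive_int_along (O : set R) i f g v z : open O ->
  v.2 0 i = 0 -> continuous f -> continuous g ->
  (forall w, O w.1 -> is_derive w v f (g w)) -> O z.1 ->
  is_derive z v (int_along i f) (int_along i g z).
Proof.
move=> oO vi cf cg dfg Oz.
have cvl : continuous (fun h : R => h *: v + z).
  by apply: cont_add; [apply: cont_scale; [exact: cont_id|exact: cont_cst]|exact: cont_cst].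
suff H : (fun h => h^-1 *: ((int_along i f \o shift z) (h *: v) - int_along i f z))
    @ 0^' --> int_along i g z.
  by apply: DeriveDef; [apply/cvg_ex; exists (int_along i g z)|exact: cvg_lim].
apply/cvgrPdist_le => e e0.
have e20 : 0 < e / (2 * L) by rewrite divr_gt0// mulr_gt0.
have Hg : \forall h \near 0 : R, forall s, s \in `[- L, L] ->
   `|g (upd i (h *: v + z) s) - g (upd i z s)| < e / (2 * L).
  have := cvl 0; rewrite /continuous_at scale0r add0r => cvl0.
  exact: (cvl0 _ (slice_near i z L cg e20)).
have HO : \forall h \near 0 : R, O (h *: v + z).1.
  have cvl1 : continuous (fun h : R => (h *: v + z).1) by exact: (cont_fst cvl).
  have := cvl1 0; rewrite /continuous_at scale0r add0r => cvl0.
  by apply: (cvl0 O); apply: open_nbhs_nbhs.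
have [d /= d0 Hd] : \forall h \near 0 : R, O (h *: v + z).1 /\ forall s, s \in `[- L, L] ->
   `|g (upd i (h *: v + z) s) - g (upd i z s)| < e / (2 * L).
  by near=> h; split; near: h.
have {Hg HO}Hd h : `|h| < d -> O (h *: v + z).1 /\ forall s, s \in `[- L, L] ->
   `|g (upd i (h *: v + z) s) - g (upd i z s)| < e / (2 * L).
  by move=> hd; apply: Hd; rewrite /ball/= sub0r normrN.
apply/nbhs_ballP; exists d => //= h; rewrite /ball/= sub0r normrN => hd h0.
have -> : h^-1 *: (int_along i f (h *: v + z) - int_along i f z) =
   int1 L (fun s => h^-1 * (f (upd i (h *: v + z) s) - f (upd i z s))).
  by rewrite int1Z ?int1B//; try apply: cont_sub; exact: cont_slice.
rewrite /int_along -int1B; last 2 first.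
  exact: cont_slice.
  by apply: cont_mul; [exact: cont_cst|apply: cont_sub; exact: cont_slice].
rewrite (_ : e = e / (2 * L) * (2 * L)); last by rewrite divfK// gt_eqF// mulr_gt0.
apply: le_abs_int1 => //.
  apply: cont_sub; first exact: cont_slice.
  by apply: cont_mul; [exact: cont_cst|apply: cont_sub; exact: cont_slice].
move=> s sL.
pose c h := upd i (h *: v + z) s.
have cE a b : c (a + b) = a *: v + c b.
  by rewrite /c !upd_shift// scalerDl addrA.
have [a|a ah] := @MVT_sym R (f \o c) (g \o c) h.
  move=> ah; apply: is_derive_line (fun b => cE b a) _.
  by apply: dfg; apply: (Hd _ _).1; exact: le_lt_trans hd.
rewrite /= {2}/c scale0r add0r => ->.
rewrite mulrC mulfK//= distrC; apply/ltW/(Hd _ _).2 => //; exact: le_lt_trans hd.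
Unshelve. all: by end_near. Qed.

Lemma int_along_axis (O : set R) i f g z : continuous g ->
  (forall w, O w.1 -> is_derive w (axis i) f (g w)) -> O z.1 ->
  int_along i g z = f (upd i z L) - f (upd i z (- L)).
Proof.
move=> cg dfg Oz; apply: (@int1_FTC R L L0 _ (fun s => f (upd i z s))).
  exact: cont_slice.
move=> s; apply: (@is_derive_line R _ f (upd i z)); last exact: dfg.
by move=> h; exact: upd_axis.
Qed.

(** The coordinates are listed explicitly so that a partial integration is again
    a function of all the variables, constant in those already integrated. *)
Definition int_list (s : seq 'I_n) f : E -> R := foldr int_along f s.

Lemma cont_int_list s f : continuous f -> continuous (int_list s f).
Proof. by move=> cf; elim: s => //= i s IH; exact: cont_int_along. Qed.

Lemma is_derive_int_list (O : set R) s f g v : open O ->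
  (forall i, i \in s -> v.2 0 i = 0) -> continuous f -> continuous g ->
  (forall w, O w.1 -> is_derive w v f (g w)) ->
  forall z, O z.1 -> is_derive z v (int_list s f) (int_list s g z).
Proof.
move=> oO vs cf cg dfg; elim: s vs => //= i s IH vs z Oz.
apply: (is_derive_int_along oO _ _ _ _ Oz); try exact: cont_int_list.
  by apply: vs; rewrite mem_head.
by apply: IH => j js; apply: vs; rewrite in_cons js orbT.
Qed.

(** P is a region that contains, with a point, the whole line of each integrated
    coordinate: typically a condition on the time, or on a coordinate not in s. *)
Lemma eq_int_list (P : set E) s f g :
  (forall i, i \in s -> forall z a, P z -> P (upd i z a)) ->
  (forall z, P z -> f z = g z) ->
  forall z, P z -> int_list s f z = int_list s g z.
Proof.
move=> + fg; elim: s => [|i s IH] Ps; first exact: fg.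
move=> z Pz; apply: eq_int1 => a _; apply: IH => [j js|]; apply: Ps => //.
  by rewrite inE js orbT.
by rewrite mem_head.
Qed.

Lemma int_listD s f g : continuous f -> continuous g ->
  forall z, int_list s (fun w => f w + g w) z = int_list s f z + int_list s g z.
Proof.
move=> cf cg; elim: s => //= i s IH z; rewrite /int_along -int1D.
- by apply: eq_int1 => a _; exact: IH.
- exact/cont_slice/cont_int_list.
- exact/cont_slice/cont_int_list.
Qed.

Lemma int_listZ s a f : continuous f ->
  forall z, int_list s (fun w => a * f w) z = a * int_list s f z.
Proof.
move=> cf; elim: s => //= i s IH z; rewrite /int_along -int1Z.
- by apply: eq_int1 => b _; exact: IH.
- exact/cont_slice/cont_int_list.
Qed.

Lemma int_list0 (P : set E) s f :
  (forall i, i \in s -> forall z a, P z -> P (upd i z a)) ->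
  (forall z, P z -> f z = 0) -> forall z, P z -> int_list s f z = 0.
Proof.
move=> Ps f0 z Pz; rewrite (@eq_int_list P s f (fun w => 0 * f w))//.
  elim: s z {Ps Pz} => /= [|i s IH] z; first by rewrite mul0r.
  by rewrite /int_along (@eq_int1 _ _ _ (fun=> 0)) ?int1_cst ?mul0r.
by move=> w Pw; rewrite f0// mulr0.
Qed.

Lemma le_int_list s f g z : continuous f -> continuous g ->
  (forall w, w.1 = z.1 -> f w <= g w) -> int_list s f z <= int_list s g z.
Proof.
move=> cf cg; elim: s z => /= [|i s IH] z fg; first exact: fg.
apply: le_int1 => //; try exact/cont_slice/cont_int_list.
by move=> a _; apply: IH.
Qed.

Lemma int_list_ge0 s f z : (forall w, 0 <= f w) -> 0 <= int_list s f z.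
Proof.
by move=> f0; elim: s z => //= i s IH z; apply: int1_ge0 => a _; exact: IH.
Qed.

(** Integration by parts.  The coordinates listed after i are integrated first
    and commute with the derivative along i; the integral along i then gives the
    values of f on two opposite faces, which vanish. *)
Lemma int_list_axis (O : set R) s i f g : open O -> uniq s -> i \in s ->
  continuous f -> continuous g ->
  (forall w, O w.1 -> is_derive w (axis i) f (g w)) ->
  (forall w : E, O w.1 -> `|w.2 0 i| = L -> f w = 0) ->
  forall z, O z.1 -> int_list s g z = 0.
Proof.
move=> oO + + cf cg dfg f0; elim: s => //= j s IH /andP[js us].
rewrite inE => /predU1P[ij|si] z Oz; last first.
  by rewrite /int_along (@eq_int1 _ _ _ (fun=> 0)) ?int1_cst ?mul0r// => a _; exact: IH.
rewrite ij in dfg f0 * => {IH}.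
have f0' (w : E) : O w.1 -> `|w.2 0 j| = L -> int_list s f w = 0.
  move=> Ow wj; apply: (@int_list0 (fun w : E => O w.1 /\ `|w.2 0 j| = L)) => //.
    move=> k ks y a [Oy yj]; split => //; rewrite upd_coord.
    by case: eqP => // jk; move: js; rewrite jk ks.
  by move=> y []; exact: f0.
have dsf w : O w.1 -> is_derive w (axis j) (int_list s f) (int_list s g w).
  apply: is_derive_int_list => // k ks; rewrite mxE eqxx/=.
  by case: eqP => // kj; move: js; rewrite -kj ks.
have -> := @int_along_axis O j _ _ z (cont_int_list cg) dsf Oz.
by rewrite !f0' ?subr0 ?upd_coord ?eqxx ?normrN ?gtr0_norm.
Qed.

Lemma int_list_gt0 s f z : continuous f -> (forall w, 0 <= f w) ->
  (forall i, i \in s -> `|z.2 0 i| < L) -> 0 < f z -> 0 < int_list s f z.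
Proof.
move=> cf f0 + fz; elim: s => //= i s IH zL.
have := zL i (mem_head _ _); rewrite ltr_norml => ziL.
apply: (@int1_gt0 R L (fun a => int_list s f (upd i z a)) (z.2 0 i)); rewrite /=.
- exact/cont_slice/cont_int_list.
- by move=> a _; exact: int_list_ge0.
- by rewrite in_itv.
- by rewrite upd_id; apply: IH => j js; apply: zL; rewrite inE js orbT.
Qed.

End Slices.

Lemma int_list_sum {R : realType} {n : nat} (L : R) (L0 : 0 < L) (s : seq 'I_n)
    {I : Type} (rI : seq I) (F : I -> R * 'rV[R]_n -> R) z :
  (forall i, continuous (F i)) ->
  int_list L s (fun w => \sum_(i <- rI) F i w) z = \sum_(i <- rI) int_list L s (F i) z.
Proof.
move=> cF; elim: rI => [|i rI IH].
  by rewrite big_nil (@int_list0 _ _ _ L0 setT)// => w _; rewrite big_nil.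
rewrite big_cons -IH -int_listD//; last exact: cont_sum.
apply: (@eq_int_list _ _ L setT) => // w _.
by rewrite big_cons.
Qed.

(** The constants of the lifespan estimate must not depend on the cube, which
    grows with the existence time; a fixed cube bounds the data from below. *)
Lemma le_int_list_widen {R : realType} {n : nat} (L L' : R) (s : seq 'I_n)
    (f : R * 'rV[R]_n -> R) z : 0 < L -> L <= L' ->
  continuous f -> (forall w, 0 <= f w) -> int_list L s f z <= int_list L' s f z.
Proof.
move=> L0 LL' cf f0; have L0' := lt_le_trans L0 LL'.
elim: s z => [|i s IH] z; first exact: lexx.
apply: (@le_trans _ _ (int1 L (fun a => int_list L' s f (upd i z a)))).
  apply: (@le_int1 _ L (fun a => int_list L s f (upd i z a))
    (fun a => int_list L' s f (upd i z a))).
  - exact/cont_slice/cont_int_list.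
  - exact/cont_slice/cont_int_list.
  - by move=> a _; exact: IH.
apply: (@le_int1_widen _ L (fun a => int_list L' s f (upd i z a)) L') => //.
  exact/cont_slice/cont_int_list.
by move=> a; exact: int_list_ge0.
Qed.

(** The bound is stated for partial integrals, with the remaining factors kept,
    so that it can be proved by induction on s. *)
Lemma int_list_prod_le {R : realType} {n : nat} (L : R) (L0 : 0 < L)
    (c a : 'I_n -> R) (s : seq 'I_n) : uniq s -> (forall i, 0 < a i) ->
  forall z : R * 'rV[R]_n,
  int_list L s (fun z => \prod_i (1 + ((z.2 0 i - c i) / a i) ^+ 2)^-1) z
  <= \prod_(i <- s) (pi * a i) *
     \prod_(i | i \notin s) (1 + ((z.2 0 i - c i) / a i) ^+ 2)^-1.
Proof.
move=> us a0.
pose q i (y : R) := (1 + ((y - c i) / a i) ^+ 2)^-1.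
have q0 i y : 0 <= q i y by rewrite invr_ge0 addr_ge0// sqr_ge0.
have cq i : continuous (q i) by exact: lorentz_continuous.
have cP (P : pred 'I_n) : continuous (fun z : R * 'rV[R]_n => \prod_(i | P i) q i (z.2 0 i)).
  by apply: cont_prod => i; exact: (cont_comp (@coord_cont _ _ i)).
suff H : forall z : R * 'rV[R]_n, int_list L s (fun z => \prod_i q i (z.2 0 i)) z
  <= \prod_(i <- s) (pi * a i) * \prod_(i | i \notin s) q i (z.2 0 i) by exact: H.
elim: s us => [_ z|i s IH /= /andP[si us] z].
  by rewrite big_nil mul1r.
pose A := \prod_(j <- s) (pi * a j).
have A0 : 0 <= A by apply: prodr_ge0 => j _; rewrite mulr_ge0 ?pi_ge0 ?ltW.
pose B := \prod_(j | j \notin i :: s) q j (z.2 0 j).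
have B0 : 0 <= B by exact: prodr_ge0.
apply: (@le_trans _ _ (int1 L (fun y => A * B * q i y))).
  apply: le_int1 => //; first exact/cont_slice/cont_int_list/cP.
    by apply: cont_mul => //; exact: cont_cst.
  move=> y _; apply: le_trans (IH us _) _; rewrite -mulrA ler_wpM2l//.
  rewrite (bigD1 i)//= upd_coord eqxx mulrC ler_wpM2r//.
  rewrite (eq_bigl (fun j => j \notin i :: s)); last first.
    by move=> j; rewrite inE negb_or andbC.
  rewrite (eq_bigr (fun j => q j (z.2 0 j)))// => j.
  by rewrite inE negb_or upd_coord => /andP[/negbTE ->].
rewrite int1Z// big_cons -/A -/B (_ : pi * a i * A * B = A * B * (pi * a i)); last by ring.
apply: ler_wpM2l; first exact: mulr_ge0.
exact: int1_lorentz.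
Qed.

(** * Powers and the function A_k *)

Lemma der_powR {R : realType} (a t : R) : 0 < t -> is_derive t 1 (fun t => t `^ a) (a * t `^ a / t).
Proof.
move=> t0; apply: (@der_val _ _ _ _ _ (a * t `^ (a - 1))).
  exact: (@is_derive1_powR R a t t0).
have tn : (a == 1) ==> (t != 0) by apply/implyP => _; rewrite gt_eqF.
by rewrite (powRB tn) powRr1 ?ltW// mulrA.
Qed.

Lemma der_powR_primitive {R : realType} (a t : R) : a < 1 -> 0 < t ->
  is_derive t 1 (fun t => t `^ (1 - a) / (1 - a)) (t `^ (- a)).
Proof.
move=> a1 t0.
apply: (der_val (is_derive_fun_mul (der_powR (1 - a) t0)
  (is_derive_fun_cst t 1 (1 - a)^-1))).
rewrite mulr0 add0r powRD; last by apply/implyP => _; rewrite gt_eqF.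
by rewrite (powRr1 (ltW t0)); field; rewrite gt_eqF//= subr_eq0 gt_eqF.
Qed.

Lemma der_A {R : realType} (k t : R) : k < 1 -> 0 < t ->
  is_derive t 1 (A k) (t `^ (- k)).
Proof.
move=> k1 t0.
apply: (der_val (is_derive_fun_sub (der_powR_primitive k1 t0)
  (is_derive_fun_cst t 1 (phi k 1)))).
by rewrite subr0.
Qed.

Lemma der_expA {R : realType} (k s t : R) : k < 1 -> 0 < t ->
  is_derive t 1 (fun t => expR (s * A k t)) (s * t `^ (- k) * expR (s * A k t)).
Proof.
move=> k1 t0; apply: (der_val (der_comp (is_derive_fun_mul (is_derive_fun_cst t 1 s) (der_A k1 t0))
  (is_derive_expR (s * A k t)))).
by rewrite mulr0 addr0 mulrC.
Qed.

Lemma powR2 {R : realType} (k t : R) : 0 < t -> t `^ (- (2 * k)) = t `^ (- k) ^+ 2.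
Proof.
move=> t0; rewrite expr2 -powRD; last by apply/implyP => _; rewrite gt_eqF.
by congr powR; ring.
Qed.

Lemma powR_antimono {R : realType} (p x y : R) : 1 < p -> 0 < x -> x <= y ->
  y `^ (1 - p) <= x `^ (1 - p).
Proof.
move=> p1 x0 xy; have y0 := lt_le_trans x0 xy.
have powE (z : R) : z `^ (1 - p) = (z `^ (p - 1))^-1 by rewrite -powRN opprB.
rewrite (powE x) (powE y) lef_pV2; last 2 first.
- by rewrite posrE powR_gt0.
- by rewrite posrE powR_gt0.
by apply: ge0_ler_powR; rewrite ?nnegrE ?subr_ge0 ?(ltW p1) ?(ltW x0) ?(ltW y0).
Qed.

(** A power lies above its tangent line at l.  Integrating this inequality and
    then choosing l is the proof of Jensen's inequality that is used below. *)
Lemma powR_tangent {R : realType} (p l x : R) : 1 < p -> 0 < l -> 0 <= x ->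
  p * l `^ (p - 1) * x - (p - 1) * l `^ p <= x `^ p.
Proof.
move=> p1 l0 x0.
have p0 : 0 < p by exact: lt_trans p1.
have q0 : 0 < p - 1 by rewrite subr_gt0.
have := @conjugate_powR R x (l `^ (p - 1)) p (p / (p - 1)) x0 (powR_ge0 _ _) p0.
rewrite divr_gt0// => /(_ isT).
have -> : p^-1 + (p / (p - 1))^-1 = 1 by field; rewrite !gt_eqF.
move=> /(_ erefl); rewrite -powRrM.
have -> : (p - 1) * (p / (p - 1)) = p by field; rewrite gt_eqF.
move=> H; have := ler_wpM2l (ltW p0) H.
have -> : p * (x `^ p / p + l `^ p / (p / (p - 1))) = x `^ p + (p - 1) * l `^ p.
  by field; rewrite !gt_eqF.
lra.
Qed.

Lemma le_A {R : realType} (k s t : R) : k < 1 -> 0 <= s -> s <= t -> A k s <= A k t.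
Proof.
move=> k1 s0 st; rewrite /A /phi lerD2r; apply: ler_wpM2r.
  by rewrite invr_ge0 subr_ge0 ltW.
by rewrite ge0_ler_powR ?nnegrE ?subr_ge0 ?(ltW k1)// (le_trans s0).
Qed.

Lemma A_at_1 {R : realType} (k : R) : A k 1 = 0.
Proof. by rewrite /A subrr. Qed.

(** * The differential inequality *)

Section Comparison.
Context {R : realType} (k p b : R) (U V N : R -> R).
Hypotheses (k0 : 0 < k) (k1 : k < 1) (p1 : 1 < p) (b1 : 1 < b).
Hypotheses (cU : continuous U) (cV : continuous V).
Hypotheses (U1 : U 1 = 0) (V1 : 0 < V 1).
Hypothesis dU : forall t : R, 1 < t < b -> is_derive t 1 U (V t).
Hypothesis dV : forall t : R, 1 < t < b -> is_derive t 1 V (t `^ (- (2 * k)) * U t + N t).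
Hypothesis N0 : forall t, 1 < t < b -> 0 <= N t.

(** Before a first zero s of V the function U is nonnegative, hence V is
    nondecreasing and V s >= V 1 > 0. *)
Lemma ode_V_gt0 t : 1 <= t <= b -> 0 < V t.
Proof.
move=> /andP[t1 tb]; rewrite ltNge; apply/negP => Vt.
pose S := `[1, b] `&` [set s | V s <= 0].
have cS : compact S.
  apply: compact_closedI; first exact: segment_compact.
  by apply: (@closed_comp _ _ V [set y | y <= 0]) => [x _|]; [exact: cV|exact: closed_le].
have [||s /[!inE] -[sab Vs] smin] := @compact_EVT_min _ R id S _ cS.
- by exists t; split => //=; rewrite in_itv/= t1 tb.
- by apply: continuous_subspaceT => x; exact: cvg_id.
move: sab; rewrite /= in_itv/= => /andP[s1 sb].
have Vpos x : 1 <= x -> x < s -> 0 < V x.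
  move=> x1 xs; rewrite ltNge; apply/negP => Vx.
  have := smin x; rewrite inE; rewrite leNgt xs => H; suff: false by []; apply: H.
  by split => //=; rewrite in_itv/= x1 (ltW (lt_le_trans xs sb)).
have Upos x : 1 <= x -> x < s -> 0 <= U x.
  move=> x1 xs; rewrite -U1; apply: (@der_ge0_le _ U V) => // [y _|y /andP[y1 yx]|y /andP[y1 yx]].
  - exact: cU.
  - by apply: dU; rewrite y1 (lt_trans yx)// (lt_le_trans xs).
  - by apply/ltW/Vpos; [exact: ltW|exact: lt_trans xs].
have : V 1 <= V s.
  apply: (@der_ge0_le _ V (fun t => t `^ (- (2 * k)) * U t + N t)) => // [y _|y /andP[y1 ys]|y /andP[y1 ys]].
  - exact: cV.
  - by apply: dV; rewrite y1 (lt_le_trans ys).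
  apply: addr_ge0; last by apply: N0; rewrite y1 (lt_le_trans ys).
  by apply: mulr_ge0; [exact: powR_ge0|apply: Upos => //; exact: ltW].
by rewrite leNgt (le_lt_trans Vs).
Qed.

Lemma ode_U_ge0 t : 1 <= t <= b -> 0 <= U t.
Proof.
move=> /andP[t1 tb]; rewrite -U1; apply: (@der_ge0_le _ U V) => // [y _|y /andP[y1 yx]|y /andP[y1 yx]].
- exact: cU.
- by apply: dU; rewrite y1 (lt_le_trans yx).
by apply/ltW/ode_V_gt0; rewrite (ltW y1) (le_trans (ltW yx)).
Qed.

(** For k = 0 these are the decaying and the growing mode of U'' = U. *)
Let D t := V t - t `^ (- k) * U t.
Let Y t := V t + t `^ (- k) * U t.

Lemma der_weighted_U (t : R) : 1 < t < b ->
  is_derive t 1 (fun t => t `^ (- k) * U t)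
   (t `^ (- k) * V t + U t * (- k * t `^ (- k) / t)).
Proof.
move=> tb; have t0 : 0 < t by move: tb => /andP[+ _]; lra.
exact: (is_derive_fun_mul (der_powR _ t0) (dU tb)).
Qed.

Lemma cont_weighted_U (t : R) : 1 <= t -> {for t, continuous (fun t => t `^ (- k) * U t)}.
Proof.
move=> t1; apply: cvgM; last exact: cU.
by apply: (der_continuous (der_powR _ (_ : 0 < t))); lra.
Qed.

(** The product e^(A_k) D is nondecreasing: its derivative is
    e^(A_k) (k t^(-k-1) U + N). *)
Lemma ode_D_ge0 t : 1 <= t <= b -> 0 <= D t.
Proof.
move=> /andP[t1 tb].
rewrite -(@pmulr_rge0 _ (expR (1 * A k t))) ?expR_gt0//.
have D1 : 0 <= expR (1 * A k 1) * D 1.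
  by rewrite /D U1 mulr0 subr0 mulr_ge0 ?expR_ge0 ?ltW.
apply: le_trans D1 _.
apply: (@der_ge0_le _ (fun t => expR (1 * A k t) * D t) (fun t => expR (A k t) *
   (k * t `^ (- k) / t * U t + N t))) => //.
- move=> x /andP[x1 xb]; apply: cvgM.
    by apply: (der_continuous (der_expA _ k1 _)); lra.
  by apply: cvgB; [exact: cV|exact: cont_weighted_U].
- move=> x /andP[x1 xt]; have x0 : 0 < x by lra.
  have xb : 1 < x < b by rewrite x1 (lt_le_trans xt).
  apply: (der_val (is_derive_fun_mul (der_expA 1 k1 x0) (is_derive_fun_sub (dV xb) (der_weighted_U xb)))).
  by rewrite /D powR2// mul1r; field; rewrite gt_eqF.
- move=> x /andP[x1 xt]; have x0 : 0 < x by lra.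
  have xb : 1 < x < b by rewrite x1 (lt_le_trans xt).
  rewrite mulr_ge0 ?expR_ge0// addr_ge0 ?N0// mulr_ge0//.
    by rewrite !mulr_ge0 ?invr_ge0 ?powR_ge0// ltW.
  by apply: ode_U_ge0; move: xb => /andP[/ltW -> /ltW ->].
Qed.

Variables (kappa beta : R) (P : R -> R).
Hypothesis kappa0 : 0 < kappa.
Hypothesis NV : forall t, 1 < t < b -> 0 < V t ->
  kappa * V t `^ p * (expR (A k t) * t `^ beta) `^ (1 - p) <= N t.
Hypothesis dP : forall t : R, 1 <= t -> is_derive t 1 P (t `^ (- ((p - 1) * (k / 2 + beta)))).

(** Y divided by the growth rate of the linear equation. *)
Let W t := t `^ (k / 2) * expR (- 1 * A k t) * Y t.

(** W' = t^(k/2) e^(-A_k) (N + (k/2t) D) by the equations of U and V.  Dropping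
    the term in D and using V >= Y/2 in the lower bound of N, all exponentials
    cancel and W^(1-p) + c P is nonincreasing, where P is a primitive of the
    remaining power of t. *)
Lemma ode_bound : (p - 1) * (kappa / 2 `^ p) * (P b - P 1) <= V 1 `^ (1 - p).
Proof.
have Y0 t : 1 <= t <= b -> 0 < Y t.
  move=> tb; rewrite ltr_pwDl ?ode_V_gt0// mulr_ge0 ?powR_ge0//.
  exact: ode_U_ge0.
have W0 t : 1 <= t <= b -> 0 < W t.
  move=> tb; rewrite mulr_gt0 ?Y0// mulr_gt0 ?expR_gt0// powR_gt0//.
  by move: tb => /andP[+ _]; lra.
have dW t : 1 < t < b -> is_derive t 1 W (t `^ (k / 2) * expR (- A k t) *
    (N t + k / 2 / t * D t)).
  move=> tb; have t0 : 0 < t by move: tb => /andP[+ _]; lra.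
  apply: (der_val (is_derive_fun_mul (is_derive_fun_mul (der_powR (k / 2) t0) (der_expA (- 1) k1 t0))
    (is_derive_fun_add (dV tb) (der_weighted_U tb)))).
  by rewrite /D /Y powR2// mulN1r; field; rewrite gt_eqF.
have cW t : 1 <= t -> {for t, continuous W}.
  move=> t1; apply: cvgM.
    apply: cvgM; first by apply: (der_continuous (der_powR _ (_ : 0 < t))); lra.
    by apply: (der_continuous (der_expA _ k1 _)); lra.
  by apply: cvgD; [exact: cV|exact: cont_weighted_U].
have W1 : W 1 = V 1.
  by rewrite /W /Y U1 mulr0 addr0 powR1 mul1r /A subrr mulr0 expR0 mul1r.
set c := (p - 1) * (kappa / 2 `^ p).
have : 0 - (W 1 `^ (1 - p) + c * P 1) <= 0 - (W b `^ (1 - p) + c * P b).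
  pose dH t := - ((1 - p) * W t `^ (1 - p) / W t * (t `^ (k / 2) * expR (- A k t) *
    (N t + k / 2 / t * D t)) + c * t `^ (- ((p - 1) * (k / 2 + beta)))).
  apply: (@der_ge0_le _ (fun t => 0 - (W t `^ (1 - p) + c * P t)) dH).
  - exact: ltW.
  - move=> x /andP[x1 xb]; apply: cvgB; first exact: cvg_cst.
    apply: cvgD.
      apply: (@continuous_comp _ _ _ W (fun y => y `^ (1 - p))); first exact: cW.
      by apply: (der_continuous (der_powR _ _)); rewrite W0 ?x1.
    by apply: cvgM; [exact: cvg_cst|exact: (der_continuous (dP x1))].
  - move=> x /andP[x1 xb]; have Wx : 0 < W x by rewrite W0 ?ltW.
    have xb' : 1 < x < b by rewrite x1.
    apply: (der_val (is_derive_fun_sub (is_derive_fun_cst x 1 0) (is_derive_fun_add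
      (der_comp (dW x xb') (der_powR (1 - p) Wx))
      (is_derive_fun_mul (is_derive_fun_cst x 1 c) (dP (ltW x1)))))).
    by rewrite mulr0 addr0 sub0r.
  - move=> t /andP[t1 tb]; have t0 : 0 < t by lra.
    have tb' : 1 < t < b by rewrite t1.
    have tb'' : 1 <= t <= b by rewrite !ltW.
    (* With Y = t^(-k/2) e^(A_k) W, the powers of e^(A_k) in V^p M^(1-p) add up
       to p + (1 - p) = 1, which the prefactor of N cancels. *)
    have NW : kappa / 2 `^ p * t `^ (- ((p - 1) * (k / 2 + beta))) * W t `^ p <=
       t `^ (k / 2) * expR (- A k t) * N t.
      have VY : Y t / 2 <= V t by have := ode_D_ge0 tb''; rewrite /Y /D; lra.
      have Vp : Y t `^ p / 2 `^ p <= V t `^ p.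
        have Vt := ode_V_gt0 tb''; have Yt := Y0 t tb''.
        rewrite ler_pdivrMr ?powR_gt0// mulrC -powRM ?(ltW Vt)//.
        rewrite ge0_ler_powR ?nnegrE ?(ltW (lt_trans ltr01 p1))//; lra.
      have NVt := NV tb' (ode_V_gt0 tb'').
      have E1 : t `^ (- ((p - 1) * (k / 2 + beta))) =
          (t `^ (k / 2)) `^ (1 - p) * (t `^ beta) `^ (1 - p).
        rewrite -!powRrM -powRD; last by apply/implyP => _; rewrite gt_eqF.
        by congr powR; ring.
      have x0 : 0 < t `^ (k / 2) by exact: powR_gt0.
      have WE : W t `^ p = (t `^ (k / 2)) `^ p * expR (- A k t) `^ p * Y t `^ p.
        by rewrite /W mulN1r !powRM ?mulr_ge0 ?expR_ge0 ?powR_ge0 ?ltW ?Y0.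
      have xE : (t `^ (k / 2)) `^ (1 - p) * (t `^ (k / 2)) `^ p = t `^ (k / 2).
        rewrite -powRD; last by apply/implyP => _; rewrite gt_eqF.
        by rewrite subrK powRr1 ?ltW.
      have eE : expR (- A k t) `^ p = expR (- A k t) * expR (A k t) `^ (1 - p).
        by rewrite -!expRM -expRD; congr expR; ring.
      rewrite (powRM (1 - p) (expR_ge0 (A k t)) (powR_ge0 t beta)) in NVt.
      rewrite E1 WE eE.
      have regroup (x1 xp q1 e1 em y y2 : R) : kappa / y2 * (x1 * q1) * (xp * (em * e1) * y) =
          x1 * xp * em * (kappa * (y / y2) * (e1 * q1)) by ring.
      rewrite regroup.
      rewrite xE ler_wpM2l ?mulr_ge0 ?expR_ge0 ?powR_ge0//; apply: le_trans NVt.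
      by rewrite ler_wpM2r ?mulr_ge0 ?powR_ge0// ler_wpM2l// ltW.
    have {}NW : kappa / 2 `^ p * t `^ (- ((p - 1) * (k / 2 + beta))) * W t `^ p <=
       t `^ (k / 2) * expR (- A k t) * (N t + k / 2 / t * D t).
      apply: (le_trans NW); rewrite ler_wpM2l ?mulr_ge0 ?expR_ge0 ?powR_ge0//.
      by rewrite lerDl !mulr_ge0 ?invr_ge0 ?ode_D_ge0// ltW.
    rewrite /dH; set X := _ * (N t + _) in NW *.
    have Wp : 0 < W t by exact: W0.
    rewrite -[_ / W t]mulrA.
    have -> : W t `^ (1 - p) / W t = (W t `^ p)^-1.
      rewrite powRB; last by apply/implyP => _; rewrite gt_eqF.
      by rewrite powRr1 ?ltW// mulrAC mulfV ?mul1r// gt_eqF.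
    have Wpp : 0 < W t `^ p by exact: powR_gt0.
    rewrite -(ler_pdivlMr _ _ Wpp) in NW.
    rewrite -mulrA (_ : c = (p - 1) * (kappa / 2 `^ p))//.
    have p10 : 0 <= p - 1 by rewrite subr_ge0 ltW.
    have := ler_wpM2l p10 NW.
    rewrite -subr_ge0 => H; apply: le_trans H _; rewrite le_eqVlt; apply/orP; left; apply/eqP.
    ring.
rewrite W1; have := powR_ge0 (W b) (1 - p); lra.
Qed.
End Comparison.

(** * The weight on the light cone *)

Lemma le_enorm {R : realType} {n : nat} (x : 'rV[R]_n) i : `|x 0 i| <= enorm x.
Proof.
rewrite -sqrtr_sqr ler_sqrt ?sumr_ge0// => [|j _]; last exact: sqr_ge0.
by rewrite (bigD1 i)//= lerDl sumr_ge0// => j _; exact: sqr_ge0.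
Qed.

(** Write x' for the coordinates other than x_0.  From |x| <= rho one gets
    |x'|^2 <= (rho - x_0)(rho + x_0) <= 2 rho (rho - x_0).  Half of rho - x_0 pays
    for the decay in x', the other half for the decay in x_0, and
    exp(-y) <= 1/(1+y), exp(-y) <= 1/(1+y^2/2) turn both into Lorentzians. *)
Lemma le_prod_expR_lorentz {R : realType} {n : nat} (i0 : 'I_n) (x : 'rV[R]_n)
    (rho : R) (c a : 'I_n -> R) : 0 < rho -> enorm x <= rho ->
  c i0 = rho -> a i0 ^+ 2 = 8 ->
  (forall i, i != i0 -> c i = 0 /\ 4 * rho <= a i ^+ 2) ->
  expR (x 0 i0) <= expR rho * \prod_i (1 + ((x 0 i - c i) / a i) ^+ 2)^-1.
Proof.
move=> rho0 xr c0 a0 ca.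
have sum_le : \sum_i x 0 i ^+ 2 <= rho ^+ 2.
  have s0 : 0 <= \sum_i x 0 i ^+ 2 by apply: sumr_ge0 => i _; exact: sqr_ge0.
  by rewrite -(sqr_sqrtr s0) ler_sqr ?nnegrE ?sqrtr_ge0// ltW.
(* The exponents of the product majorant: they add up to at most rho - x_0. *)
pose g i := if i == i0 then (rho - x 0 i0) / 2 else x 0 i ^+ 2 / (4 * rho).
have xr' : x 0 i0 <= rho by apply: le_trans (ler_norm _) _; apply: le_trans xr; exact: le_enorm.
have H1 : x 0 i0 <= rho - \sum_i g i.
  rewrite (bigD1 i0)//= {1}/g eqxx.
  rewrite (eq_bigr (fun i => x 0 i ^+ 2 / (4 * rho))); last by move=> i /negbTE; rewrite /g => ->.
  rewrite -mulr_suml; rewrite (bigD1 i0)//= in sum_le.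
  set S := \sum_(i | i != i0) _ in sum_le *.
  have -> : S / (4 * rho) = S / rho / 4 by field; rewrite gt_eqF.
  have : S / rho <= 2 * (rho - x 0 i0).
    rewrite ler_pdivrMr//.
    have : 0 <= (rho - x 0 i0) ^+ 2 by exact: sqr_ge0.
    rewrite !expr2 in sum_le *; nra.
  lra.
have H2 i : expR (- g i) <= (1 + ((x 0 i - c i) / a i) ^+ 2)^-1.
  rewrite expRN lef_pV2 ?posrE ?expR_gt0 ?ltr_pwDl ?sqr_ge0//.
  rewrite /g; case: eqVneq => [->|ii0].
    rewrite c0 expr_div_n a0.
    have := @expR_ge1Dxn R ((rho - x 0 i0) / 2) 1; rewrite divr_ge0 ?subr_ge0// => /(_ isT).
    apply: le_trans; rewrite lerD2l expr_div_n.
    rewrite le_eqVlt; apply/orP; left; apply/eqP.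
    by rewrite !factS fact0; field.
  have [-> ai] := ca i ii0.
  rewrite subr0 expr_div_n; apply: le_trans (expR_ge1Dx _); rewrite lerD2l.
  have r4 : 0 < 4 * rho by rewrite mulr_gt0.
  by rewrite ler_wpM2l ?sqr_ge0// lef_pV2 ?posrE// (lt_le_trans r4).
apply: (@le_trans _ _ (expR (rho - \sum_i g i))); first by rewrite ler_expR.
rewrite expRD ler_wpM2l ?expR_ge0// -sumrN expR_sum.
by apply: ler_prod => i _; rewrite expR_ge0 H2.
Qed.

(** The profile has width sqrt 8 along i0.  In the other directions it must be at
    least 2 sqrt(r + A_k(t)), and r + A_k(t) <= (r + 1/(1-k)) t^(1-k); the power
    of t is factored out, here and in the next two definitions, so that the
    integral of the majorant is majorant_const * e^(A_k) * t^majorant_exp. *)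
Definition majorant_width {R : realType} {n : nat} (k r : R) (i0 i : 'I_n) : R :=
  if i == i0 then Num.sqrt 8 else Num.sqrt (4 * (r + (1 - k)^-1)).

Definition majorant_const {R : realType} {n : nat} (k r : R) (i0 : 'I_n) : R :=
  expR r * \prod_i (pi * majorant_width k r i0 i).

Definition majorant_exp {R : realType} (k : R) (n : nat) : R :=
  (1 - k) * (n%:R - 1) / 2.

Lemma majorant_width_gt0 {R : realType} {n : nat} (k r : R) (i0 i : 'I_n) :
  0 < r -> k < 1 -> 0 < majorant_width k r i0 i.
Proof.
move=> r0 k1; rewrite /majorant_width; case: eqP => _; rewrite sqrtr_gt0//.
by rewrite mulr_gt0// addr_gt0// invr_gt0 subr_gt0.
Qed.

Lemma majorant_const_gt0 {R : realType} {n : nat} (k r : R) (i0 : 'I_n) :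
  0 < r -> k < 1 -> 0 < majorant_const k r i0.
Proof.
move=> r0 k1; rewrite mulr_gt0 ?expR_gt0// prodr_gt0// => i _.
by rewrite mulr_gt0 ?pi_gt0 ?majorant_width_gt0.
Qed.

(** * Exponential moments of a solution *)

Lemma der_exp_coord {R : realType} {n : nat} (z v : R * 'rV[R]_n) (i : 'I_n) :
  is_derive z v (fun w : R * 'rV[R]_n => expR (w.2 0 i)) (v.2 0 i * expR (z.2 0 i)).
Proof.
apply: is_derive_along.
rewrite (_ : (fun h => _) = (fun h => expR (h * v.2 0 i + z.2 0 i))); last first.
  by apply/funext => h; rewrite !mxE.
have dlin : is_derive (0 : R) 1 (fun h : R => h * v.2 0 i + z.2 0 i) (v.2 0 i).
  apply: (der_val (is_derive_fun_add (is_derive_fun_mul (is_derive_id (0 : R) (1 : R)) (is_derive_fun_cst (0 : R) 1 (v.2 0 i)))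
    (is_derive_fun_cst (0 : R) 1 (z.2 0 i)))).
  by rewrite mulr0 mulr1 add0r addr0.
by apply: (der_val (der_comp dlin (is_derive_expR _))); rewrite mul0r add0r mulrC.
Qed.

Definition exp_weight {R : realType} {n : nat} (i0 : 'I_n) (z : R * 'rV[R]_n) : R :=
  expR (z.2 0 i0).

(** The integral of f(t,x) exp(x_0) over the cube of side 2L.  The base point y0
    does not affect the value, as every coordinate is integrated; choosing it
    where the datum is positive makes positivity of the moment immediate. *)
Definition exp_moment {R : realType} {n : nat} (L : R) (i0 : 'I_n) (y0 : 'rV[R]_n)
    (f : R * 'rV[R]_n -> R) (t : R) : R :=
  int_list L (enum 'I_n) (fun z => f z * exp_weight i0 z) (t, y0).

Lemma cont_exp_weight {R : realType} {n : nat} (i0 : 'I_n) :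
  continuous (exp_weight i0 : R * 'rV[R]_n -> R).
Proof. by apply: (cont_comp (@coord_cont R n i0)) => x; exact: continuous_expR. Qed.

(** The functions u, ut, utt, ux, uxx stand for a solution and its derivatives,
    continuous on the whole space and related to one another only for
    1 < t < b.  The factor q stands for t^(-2k), so that the right-hand side
    |u_t|^p is represented by the continuous function utt - q * sum uxx. *)
Section ExponentialMoments.
Context {R : realType} {n : nat} (k p r b L : R) (i0 : 'I_n) (y0 : 'rV[R]_n).
Local Notation E := (R * 'rV[R]_n)%type.
Variables (u ut utt q : E -> R) (ux uxx : 'I_n -> E -> R).
Hypotheses (hk0 : 0 < k) (hk1 : k < 1) (hp1 : 1 < p) (hr : 0 < r) (b1 : 1 < b).
Hypothesis bL : r + A k b < L.
Hypotheses (cu : continuous u) (cut : continuous ut) (cutt : continuous utt)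
  (cq : continuous q) (cux : forall j, continuous (ux j))
  (cuxx : forall j, continuous (uxx j)).

Let O : set R := [set t | 1 < t < b].
Hypothesis du : forall z : E, O z.1 -> is_derive z ((1, 0) : E) u (ut z).
Hypothesis dut : forall z : E, O z.1 -> is_derive z ((1, 0) : E) ut (utt z).
Hypothesis dux : forall (j : 'I_n) (z : E), O z.1 -> is_derive z (axis j) u (ux j z).
Hypothesis duxx : forall (j : 'I_n) (z : E), O z.1 -> is_derive z (axis j) (ux j) (uxx j z).
Hypothesis qE : forall z : E, O z.1 -> q z = z.1 `^ (- (2 * k)).
Hypothesis wave : forall z : E, O z.1 ->
  utt z - q z * \sum_j uxx j z = `|ut z| `^ p.
Hypothesis u_supp : forall z : E, 1 <= z.1 <= b -> r + A k z.1 <= enorm z.2 -> u z = 0.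

Local Notation phi_ := (exp_weight i0).
Local Notation moment := (exp_moment L i0 y0).

Let L0 : 0 < L.
Proof.
have := le_A hk1 ler01 (ltW b1); rewrite A_at_1 => A0.
apply: lt_trans bL; exact: ltr_pwDl.
Qed.

Let Oo : open O.
Proof. by rewrite (_ : O = `]1, b[%classic); [exact: interval_open|rewrite set_itvE]. Qed.

Lemma cont_moment f : continuous f -> continuous (moment f).
Proof.
move=> cf.
have cl : continuous (fun t : R => (t, y0) : E) by apply: cont_pair; [exact: cont_id|exact: cont_cst].
apply: (cont_comp cl); apply: cont_int_list => //.
by apply: cont_mul => //; exact: cont_exp_weight.
Qed.

Lemma der_phi_t (z : E) : is_derive z ((1, 0) : E) phi_ 0.
Proof. by apply: (der_val (der_exp_coord _ _ _)); rewrite mxE mul0r. Qed.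

Lemma der_phi_x (z : E) j : is_derive z (axis j) phi_ ((j == i0)%:R * phi_ z).
Proof. by apply: (der_val (der_exp_coord _ _ _)); rewrite mxE eqxx/= eq_sym. Qed.

Lemma der_moment f df t : continuous f -> continuous df ->
  (forall z : E, O z.1 -> is_derive z ((1, 0) : E) f (df z)) ->
  O t -> is_derive t 1 (moment f) (moment df t).
Proof.
move=> cf cdf dfE Ot; rewrite /exp_moment.
have cE h : ((h + t, y0) : E) = h *: ((1, 0) : E) + (t, y0).
  by congr (_, _) => /=; [rewrite /GRing.scale/= mulr1|rewrite scaler0 add0r].
apply: (@is_derive_line R E _ (fun t => (t, y0) : E) ((1, 0) : E) _ t cE).
apply: (@is_derive_int_list R n L L0 O) => //.
- by move=> i _; rewrite mxE.
- by apply: cont_mul => //; exact: cont_exp_weight.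
- by apply: cont_mul => //; exact: cont_exp_weight.
move=> w Ow; apply: (der_val (is_derive_fun_mul (dfE w Ow) (der_phi_t w))).
by rewrite mulr0 add0r mulrC.
Qed.

(** Since r + A_k(b) < L, the solution vanishes near the faces of the cube, and
    with it the normal derivative on the faces. *)
Lemma u_face (z : E) j : O z.1 -> r + A k b < `|z.2 0 j| -> u z = 0.
Proof.
move=> /andP[z1 zb] zj; apply: u_supp; first by rewrite (ltW z1) (ltW zb).
apply: le_trans (le_enorm _ j); apply: le_trans (ltW zj).
by rewrite lerD2l le_A// ltW// (lt_trans ltr01).
Qed.

Lemma ux_face (z : E) j : O z.1 -> `|z.2 0 j| = L -> ux j z = 0.
Proof.
move=> Oz zj.
have d1 := @is_derive_line R E u (upd j z) (axis j) (ux j z) (z.2 0 j).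
rewrite upd_id in d1.
apply: (@der_near0 _ (u \o upd j z) (z.2 0 j)).
  have cn : continuous (fun s : R => `|s|) by apply: cont_norm; exact: cont_id.
  have : \forall s \near z.2 0 j, r + A k b < `|s|.
    by apply: (cvgr_gt _ (cn (z.2 0 j))); rewrite zj.
  apply: filterS => s sL; apply: (@u_face _ j) => //.
  by rewrite upd_coord eqxx.
by apply: d1; [move=> h; rewrite -[in RHS](upd_id j z) upd_axis upd_id|exact: dux].
Qed.

Lemma ut_outside_cone (z : E) : O z.1 -> r + A k z.1 < enorm z.2 -> ut z = 0.
Proof.
move=> /[dup] Oz /andP[z1 zb] zr.
have z0 : 0 < z.1 by lra.
have cE h : ((h + z.1, z.2) : E) = h *: ((1, 0) : E) + (z.1, z.2).
  by congr (_, _) => /=; [rewrite /GRing.scale/= mulr1|rewrite scaler0 add0r].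
have d1 := @is_derive_line R E u (fun t => (t, z.2)) ((1, 0) : E) (ut z) z.1 cE.
apply: (@der_near0 _ (u \o (fun t => (t, z.2))) z.1); last first.
  by apply: d1; rewrite -surjective_pairing; exact: du.
have cA := der_continuous (der_A hk1 z0).
have : \forall s \near z.1, A k s < enorm z.2 - r.
  by apply: (cvgr_lt _ cA); rewrite ltrBrDl.
have : \forall s \near z.1, O s by exact: open_nbhs_nbhs.
apply: filterS2 => s /andP[s1 sb] sr; apply: u_supp => /=; first by rewrite (ltW s1) (ltW sb).
by rewrite -lerBrDl ltW.
Qed.

(** The sum over j of uxx j * phi - (j == i0) u phi is the divergence of the field
    with components (ux j - (j == i0) u) phi, because phi is its own derivative
    along i0; hence the Laplacian of u and u itself have the same moment. *)
Lemma der_moment_ut t : O t ->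
  is_derive t 1 (moment ut) (t `^ (- (2 * k)) * moment u t +
     moment (fun z => utt z - q z * \sum_j uxx j z) t).
Proof.
move=> Ot; apply: (der_val (der_moment cut cutt dut Ot)).
have cphi : continuous (phi_ : E -> R) by exact: cont_exp_weight.
have csum : continuous (fun z => \sum_j uxx j z).
  exact: cont_sum.
have cpos : continuous (fun z => (utt z - q z * \sum_j uxx j z)).
  by apply: cont_sub => //; exact: cont_mul.
have -> : moment utt t = moment (fun z => q z * \sum_j uxx j z) t +
    moment (fun z => utt z - q z * \sum_j uxx j z) t.
  rewrite /exp_moment -int_listD//; last 2 first.
  - by apply: cont_mul => //; exact: cont_mul.
  - exact: cont_mul.
  by apply: (@eq_int_list _ _ L setT) => // z _; ring.
congr (_ + _).
(* G j is the j-th term of a divergence. *)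
pose G j z := (uxx j z - (j == i0)%:R * u z) * phi_ z.
have cG j : continuous (G j).
  apply: cont_mul => //; apply: cont_sub => //; apply: cont_mul => //; exact: cont_cst.
have G0 j : int_list L (enum 'I_n) (G j) (t, y0) = 0.
  apply: (@int_list_axis _ _ _ L0 O _ j (fun z => (ux j z - (j == i0)%:R * u z) * phi_ z)) => //.
  - exact: enum_uniq.
  - by rewrite mem_enum.
  - apply: cont_mul => //; apply: cont_sub => //; apply: cont_mul => //; exact: cont_cst.
  - move=> w Ow; apply: (der_val (is_derive_fun_mul (is_derive_fun_sub (duxx j Ow)
      (is_derive_fun_mul (is_derive_fun_cst _ _ _) (dux j Ow))) (der_phi_x w j))).
    by rewrite /G; case: (j == i0) => /=; ring.
  - move=> w Ow wL; rewrite (ux_face Ow wL) (@u_face w j Ow) ?wL//.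
    by rewrite mulr0 subr0 mul0r.
rewrite /exp_moment.
rewrite (@eq_int_list _ _ L [set z | z.1 = t] _ _
  (fun z => t `^ (- (2 * k)) * (u z * phi_ z + \sum_j G j z)))//; last first.
  move=> z /= zt; rewrite qE ?zt// -mulrA; congr (_ * _).
  have S1 : \sum_j (j == i0)%:R = 1 :> R.
    by rewrite (bigD1 i0)//= eqxx big1 ?addr0// => j /negbTE ->.
  by rewrite /G -mulr_suml -mulrDl sumrB -mulr_suml S1; ring.
have cSG : continuous (fun z => \sum_j G j z).
  exact: cont_sum.
have cup : continuous (fun z => u z * phi_ z) by exact: cont_mul.
rewrite int_listZ//; last exact: cont_add.
rewrite int_listD// int_list_sum// big1 ?addr0//.
Qed.

(** Pointwise, |u_t|^p phi >= p lam^(p-1) u_t phi - (p-1) lam^p w with w the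
    majorant of phi: inside the cone by the tangent inequality, and outside
    because u_t = 0 while w >= 0.  The majorant replaces the indicator function
    of the ball, which is not continuous. *)
Lemma moment_power_tangent t (lam : R) (c a : 'I_n -> R) : O t -> 0 < lam ->
  c i0 = r + A k t -> a i0 ^+ 2 = 8 -> (forall i, 0 < a i) ->
  (forall i, i != i0 -> c i = 0 /\ 4 * (r + A k t) <= a i ^+ 2) ->
  p * lam `^ (p - 1) * moment ut t -
    (p - 1) * lam `^ p * (expR (r + A k t) * \prod_i (pi * a i)) <=
  moment (fun z => utt z - q z * \sum_j uxx j z) t.
Proof.
move=> Ot lam0 c0 a0 apos ca.
have /andP[t1 tb] := Ot.
pose rho := r + A k t.
have rho0 : 0 < rho.
  by have := le_A hk1 ler01 (ltW t1); rewrite A_at_1 => A0; exact: ltr_pwDl.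
have cphi : continuous (phi_ : E -> R) by exact: cont_exp_weight.
pose q_ (z : E) : R := \prod_i (1 + ((z.2 0 i - c i) / a i) ^+ 2)^-1.
have q_ge0 z : 0 <= q_ z.
  by apply: prodr_ge0 => i _; rewrite invr_ge0 addr_ge0// sqr_ge0.
have cq_ : continuous q_.
  apply: cont_prod => i.
  exact: (cont_comp (@coord_cont R n i) (@lorentz_continuous R (c i) (a i))).
have csum : continuous (fun z => \sum_j uxx j z) by exact: cont_sum.
have cpos : continuous (fun z => (utt z - q z * \sum_j uxx j z)).
  by apply: cont_sub => //; exact: cont_mul.
pose w z := p * lam `^ (p - 1) * (ut z * phi_ z) +
   - ((p - 1) * lam `^ p * expR rho) * q_ z.
have c1 : continuous (fun z => ut z * phi_ z) by exact: cont_mul.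
have cw : continuous w.
  by apply: cont_add; apply: cont_mul => //; exact: cont_cst.
have p10 : 0 <= p - 1 by rewrite subr_ge0 ltW.
have wle : int_list L (enum 'I_n) w (t, y0) <= moment (fun z => utt z - q z * \sum_j uxx j z) t.
  apply: le_int_list => //; first exact: cont_mul.
  move=> z zt; rewrite wave ?zt// /w.
  have [zr|zr] := leP (enorm z.2) rho; last first.
    rewrite (@ut_outside_cone z) ?zt// normr0 powR0 ?gt_eqF ?(lt_trans ltr01)//.
    by rewrite !mul0r mulr0 add0r mulNr oppr_le0 !mulr_ge0 ?powR_ge0 ?expR_ge0.
  have Hphi : phi_ z <= expR rho * q_ z by exact: le_prod_expR_lorentz.
  have phi0 : 0 <= phi_ z by exact: expR_ge0.
  have Htan := ler_wpM2r phi0 (powR_tangent hp1 lam0 (normr_ge0 (ut z))).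
  apply: le_trans Htan; rewrite mulNr.
  rewrite [leRHS](_ : _ = p * lam `^ (p - 1) * (`|ut z| * phi_ z) -
    (p - 1) * lam `^ p * phi_ z); last by ring.
  apply: lerB.
    rewrite ler_wpM2l ?ler_wpM2r ?ler_norm// mulr_ge0 ?powR_ge0//.
    by rewrite ltW// (lt_trans ltr01).
  by rewrite -[leRHS]mulrA ler_wpM2l// mulr_ge0 ?powR_ge0.
apply: le_trans wle; rewrite /w int_listD//; last 2 first.
- by apply: cont_mul => //; exact: cont_cst.
- by apply: cont_mul => //; exact: cont_cst.
rewrite !int_listZ// lerD2l mulNr lerN2.
rewrite -[leLHS]mulrA; apply: ler_wpM2l; first by rewrite mulr_ge0 ?powR_ge0.
apply: ler_wpM2l; first exact: expR_ge0.
apply: le_trans (int_list_prod_le L0 c (enum_uniq _) apos (t, y0)) _.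
rewrite big_enum/= [X in _ * X]big1 ?mulr1// => i.
by rewrite mem_enum.
Qed.

(** Jensen's inequality, from the previous lemma with lam = V / M where M is the
    integral of the majorant: then p lam^(p-1) V - (p-1) lam^p M = V^p M^(1-p). *)
Lemma moment_power_ge t : O t -> 0 < moment ut t ->
  majorant_const k r i0 `^ (1 - p) * moment ut t `^ p *
    (expR (A k t) * t `^ majorant_exp k n) `^ (1 - p) <=
  moment (fun z => utt z - q z * \sum_j uxx j z) t.
Proof.
move=> Ot V0.
have /andP[t1 tb] := Ot.
have t0 : 0 < t by exact: lt_trans t1.
set V := moment ut t in V0 *.
set N := moment _ t.
set Kc := majorant_const k r i0.
have Kc0 : 0 < Kc by apply: majorant_const_gt0.
pose M := Kc * (expR (A k t) * t `^ majorant_exp k n).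
have M0 : 0 < M by rewrite mulr_gt0// mulr_gt0 ?expR_gt0// powR_gt0.
pose lam := V * M `^ (- 1).
have lamE x : lam `^ x = V `^ x * M `^ (- x).
  by rewrite powRM ?powR_ge0 ?(ltW V0)// -powRrM mulN1r.
have lam0 : 0 < lam by rewrite mulr_gt0// powR_gt0.
pose c i := if i == i0 then r + A k t else 0.
pose a i := majorant_width k r i0 i * (if i == i0 then 1 else t `^ ((1 - k) / 2)).
have a_gt0 i : 0 < a i.
  by rewrite /a mulr_gt0 ?majorant_width_gt0//; case: eqP => // _; rewrite powR_gt0.
have ME : expR (r + A k t) * \prod_i (pi * a i) = M.
  rewrite /M /Kc /majorant_const expRD.
  rewrite (eq_bigr (fun i => (pi * majorant_width k r i0 i) * (if i == i0 then 1 else t `^ ((1 - k) / 2)))); last first.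
    by move=> i _; rewrite /a mulrA.
  have PE : \prod_(i < n) (if i == i0 then 1 else t `^ ((1 - k) / 2)) = t `^ majorant_exp k n.
    rewrite (bigD1 i0)//= eqxx mul1r (eq_bigr (fun=> t `^ ((1 - k) / 2))); last first.
      by move=> i /negbTE ->.
    rewrite prodr_const cardC1 card_ord -powR_mulrn ?powR_ge0// -powRrM.
    congr powR; rewrite /majorant_exp -subn1 natrB ?(leq_ltn_trans _ (ltn_ord i0))//.
    by rewrite mulrAC.
  by rewrite big_split/= PE; ring.
have C0 : c i0 = r + A k t by rewrite /c eqxx.
have A0 : a i0 ^+ 2 = 8 by rewrite /a /majorant_width eqxx mulr1 sqr_sqrtr.
have t1k : 1 <= t `^ (1 - k).
  by rewrite -[leLHS](powRr0 t) ler_powR ?(ltW t1)// subr_ge0 ltW.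
have k1' : 0 < (1 - k)^-1 by rewrite invr_gt0 subr_gt0.
have CA i : i != i0 -> c i = 0 /\ 4 * (r + A k t) <= a i ^+ 2.
  move=> /negbTE ii0; rewrite /c /a /majorant_width ii0; split => //.
  have w0 : 0 <= 4 * (r + (1 - k)^-1) by rewrite mulr_ge0// addr_ge0// ltW.
  rewrite exprMn sqr_sqrtr//.
  rewrite -powR_mulrn ?powR_ge0// -powRrM (_ : (1 - k) / 2 * 2%:R = 1 - k); last by field.
  rewrite -mulrA ler_wpM2l// mulrDl lerD ?ler_peMr ?(ltW hr)//.
  by rewrite /A /phi powR1 mul1r [leRHS]mulrC gerBl ltW.
have H := moment_power_tangent Ot lam0 C0 A0 a_gt0 CA.
rewrite ME !lamE in H; apply: le_trans H.
have E1 : V `^ (p - 1) * V = V `^ p by rewrite mulrC mulr_powRB1 ?ltW// (lt_trans ltr01).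
have E2 : M `^ (- p) * M = M `^ (1 - p).
  rewrite -{2}(powRr1 (ltW M0)) -powRD; last by apply/implyP => _; rewrite gt_eqF.
  by rewrite addrC.
have E3 : M `^ (1 - p) = Kc `^ (1 - p) * (expR (A k t) * t `^ majorant_exp k n) `^ (1 - p).
  by apply: powRM; [exact: ltW|rewrite mulr_ge0 ?expR_ge0 ?powR_ge0].
rewrite -/V opprB [leRHS](_ : _ = p * (V `^ (p - 1) * V) * M `^ (1 - p) -
  (p - 1) * V `^ p * (M `^ (- p) * M)); last by ring.
rewrite E1 E2 E3 le_eqVlt; apply/orP; left; apply/eqP; ring.
Qed.

Lemma moment_bound (P : R -> R) :
  (forall t : R, 1 <= t ->
     is_derive t 1 P (t `^ (- ((p - 1) * (k / 2 + majorant_exp k n))))) ->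
  moment u 1 = 0 -> 0 < moment ut 1 ->
  (p - 1) * (majorant_const k r i0 `^ (1 - p) / 2 `^ p) * (P b - P 1) <=
    moment ut 1 `^ (1 - p).
Proof.
move=> dP U1 V1.
have csum : continuous (fun z => \sum_j uxx j z) by exact: cont_sum.
have N0 t : 1 < t < b -> 0 <= moment (fun z => utt z - q z * \sum_j uxx j z) t.
  move=> Ot; rewrite /exp_moment (@eq_int_list _ _ L [set z | O z.1] _ _ (fun z => `|ut z| `^ p * phi_ z))//.
    by apply: int_list_ge0 => z; rewrite mulr_ge0 ?powR_ge0 ?expR_ge0.
  by move=> z Oz; rewrite wave.
apply: (@ode_bound R k p b (moment u) (moment ut) (moment (fun z => utt z - q z * \sum_j uxx j z))) => //.
- exact: cont_moment.
- exact: cont_moment.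
- by move=> t Ot; exact: der_moment.
- by move=> t Ot; exact: der_moment_ut.
- by rewrite powR_gt0// majorant_const_gt0.
- by move=> t Ot V0; exact: moment_power_ge.
Qed.
End ExponentialMoments.

(** * Restriction to a compact time interval *)

(** Freezing a function of (t,x) before t = 1 and after t = b yields a function
    that is continuous on the whole space and agrees with the original near each
    point with 1 < t < b. *)
Definition clamp {R : realType} {n : nat} (b : R) (z : R * 'rV[R]_n) : R * 'rV[R]_n :=
  (Num.max 1 (Num.min z.1 b), z.2).

Section Clamp.
Context {R : realType} {n : nat} (b : R) (T : \bar R).
Hypotheses (b1 : 1 < b) (bT : (b%:E < T)%E).
Local Notation E := (R * 'rV[R]_n)%type.
Implicit Types (z v : E) (f : E -> R).

Lemma clamp_strip z : strip T (clamp b z).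
Proof.
split; rewrite /clamp/=; first by rewrite le_max lexx.
by apply: le_lt_trans bT; rewrite lee_fin ge_max ge_min lexx orbT (ltW b1).
Qed.

Lemma clamp_ge1 z : 1 <= (clamp b z).1.
Proof. by rewrite /clamp/= le_max lexx. Qed.

Lemma clamp_id z : 1 <= z.1 <= b -> clamp b z = z.
Proof.
by case: z => t x /= /andP[t1 tb]; rewrite /clamp/= min_l// max_r.
Qed.

Lemma cont_clamp : continuous (@clamp R n b).
Proof.
apply: cont_pair; last exact/cont_snd/cont_id.
apply: (@cont_comp _ _ _ (fun z : E => z.1) (fun t => Num.max 1 (Num.min t b))).
  exact/cont_fst/cont_id.
apply: max_fun_continuous; first exact: cont_cst.
by apply: min_fun_continuous; [exact: cont_id|exact: cont_cst].
Qed.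

Lemma cont_clamped f : {within strip T, continuous f} -> continuous (fun z => f (clamp b z)).
Proof. by apply: cont_comp_within; [exact: cont_clamp|exact: clamp_strip]. Qed.

Lemma open_times : open [set z : E | 1 < z.1 < b].
Proof.
rewrite (_ : [set z : E | _] = (fst : E -> R) @^-1` `]1, b[%classic); last first.
  by rewrite set_itvE.
apply: open_comp; last exact: interval_open.
by move=> z _; exact: (cont_fst cont_id).
Qed.

Lemma near_clamp_id z : 1 < z.1 < b -> \near z, clamp b z = z.
Proof.
move=> zb; have := open_nbhs_nbhs (conj open_times zb).
by apply: filterS => w /andP[w1 wb]; rewrite clamp_id// !ltW.
Qed.

Lemma interior_strip z : 1 < z.1 < b -> interior (strip T) z.
Proof.
move=> zb; have := open_nbhs_nbhs (conj open_times zb).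
apply: filterS => w /andP[w1 wb]; split; first exact: ltW.
by apply: lt_trans bT; rewrite lte_fin.
Qed.

Lemma der_clamped f z v d : 1 < z.1 < b -> is_derive z v f d ->
  is_derive z v (fun z => f (clamp b z)) d.
Proof.
move=> zb; apply: near_eq_is_derive.
by apply: filterS (near_clamp_id zb) => w ->.
Qed.

Lemma clamped_derivative f (v : E) g : (forall z, interior (strip T) z -> is_derive z v f (g z)) ->
  forall z, 1 < z.1 < b -> is_derive z v (fun z => f (clamp b z)) (g (clamp b z)).
Proof.
move=> fg z zb; rewrite clamp_id; last by move: zb => /andP[/ltW -> /ltW ->].
by apply: der_clamped => //; exact/fg/interior_strip.
Qed.

End Clamp.

(** * The lifespan estimate *)

Lemma exp_moment_gt0 {R : realType} {n : nat} (r : R) (i0 : 'I_n) (x0 : 'rV[R]_n)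
    (g : 'rV[R]_n -> R) : 0 < r -> continuous g -> (forall x, 0 <= g x) ->
  enorm x0 < r -> 0 < g x0 -> 0 < exp_moment r i0 x0 (fun z => g z.2) 1.
Proof.
move=> r0 cg g0 x0r gx0; apply: int_list_gt0 => //.
- apply: cont_mul; last exact: cont_exp_weight.
  by apply: (cont_comp _ cg); exact/cont_snd/cont_id.
- by move=> w; rewrite mulr_ge0 ?expR_ge0.
- by move=> i _; apply: le_lt_trans x0r; exact: le_enorm.
- by rewrite mulr_gt0 ?expR_gt0.
Qed.

(** The left-hand side is a constant times the integral from 1 to b of the power
    of t in the hypothesis on P.  Neither that constant nor the moment of g on
    the right depends on eps, u or T, and b is any time before T, so that both
    lifespan bounds follow by solving this inequality for b. *)
Lemma lifespan_inequality {R : realType} {n : nat} (k p r eps b : R) (T : \bar R)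
    (i0 : 'I_n) (x0 : 'rV[R]_n) (f g : 'rV[R]_n -> R) (u : R * 'rV[R]_n -> R)
    (P : R -> R) :
  0 < k -> k < 1 -> 1 < p -> 0 < r -> 0 < eps -> 1 < b -> (b%:E < T)%E ->
  (forall x, f x = 0) -> continuous g -> (forall x, 0 <= g x) ->
  enorm x0 < r -> 0 < g x0 ->
  local_solution k p f (fun x => eps * g x) T u ->
  (forall t : R, 1 <= t -> (t%:E < T)%E ->
    supp (fun x : 'rV[R]_n => u (t, x)) `<=` eball (r + A k t)) ->
  (forall t : R, 1 <= t ->
    is_derive t 1 P (t `^ (- ((p - 1) * (k / 2 + majorant_exp k n))))) ->
  (p - 1) * (majorant_const k r i0 `^ (1 - p) / 2 `^ p) * (P b - P 1) <=
    (eps * exp_moment r i0 x0 (fun z => g z.2) 1) `^ (1 - p).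
Proof.
move=> k0 k1 p1 r0 eps0 b1 bT f0 cg g0 x0r gx0 [T1 C2 weq ini inidt] usupp dP.
case: C2 => cu Du.
have [ut [[cut Dut] dut]] := Du (1, 0).
have [utt [[cutt _] dutt]] := Dut (1, 0).
have /choice [ux Hux] : forall j : 'I_n, exists h, Cj_on 1 (strip T) h /\
    (forall z, interior (strip T) z -> is_derive z (axis j) u (h z)).
  by move=> j; exact: Du.
have /choice [uxx Huxx] : forall j : 'I_n, exists h, Cj_on 0 (strip T) h /\
    (forall z, interior (strip T) z -> is_derive z (axis j) (ux j) (h z)).
  by move=> j; have [[_ H] _] := Hux j; exact: H.
pose cl (h : R * 'rV[R]_n -> R) z := h (clamp b z).
(* The margin 1 keeps the support of u away from the faces of the cube. *)
pose L := r + A k b + 1.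
have bL : r + A k b < L by rewrite ltrDl.
have Ab : 0 <= A k b by rewrite -(A_at_1 k) le_A// ltW.
have L0 : 0 < L by rewrite addr_gt0// ltr_pwDl.
pose q (z : R * 'rV[R]_n) := (clamp b z).1 `^ (- (2 * k)).
have cc1 : continuous (fun z : R * 'rV[R]_n => (clamp b z).1).
  by apply: cont_fst; exact: cont_clamp.
have cq : continuous q.
  move=> z; apply: (@cvg_comp _ _ _ (fun z : R * 'rV[R]_n => (clamp b z).1)
    (fun y => y `^ (- (2 * k)))); first exact: cc1.
  apply: (der_continuous (der_powR _ _)).
  by apply: lt_le_trans (clamp_ge1 b z).
have inn (z : R * 'rV[R]_n) : 1 < z.1 < b -> interior (strip T) z by exact: interior_strip.
have wave (z : R * 'rV[R]_n) : 1 < z.1 < b ->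
    cl utt z - q z * \sum_j cl (uxx j) z = `|cl ut z| `^ p.
  move=> /[dup] zb /andP[z1 zb'].
  have near_inn : \near z, interior (strip T) z.
    have := open_nbhs_nbhs (conj (@open_times R n b) zb).
    by apply: filterS => w; exact: inn.
  have dtu w : interior (strip T) w -> dt u w = ut w.
    by move=> /dut H; rewrite /dt derive_val.
  have dxu j w : interior (strip T) w -> dx j u w = ux j w.
    by move=> /((Hux j).2 w) H; rewrite /dx -/(axis j) derive_val.
  have zT : (z.1%:E < T)%E by apply: lt_trans bT; rewrite lte_fin.
  have := weq z.1 z.2 z1 zT; rewrite -surjective_pairing /laplacian.
  have -> : dt (dt u) z = utt z.
    rewrite {1}/dt (near_eq_derive _ (g := ut)); last by apply: filterS near_inn => w /dtu.
    by have H := dutt z (inn z zb); rewrite derive_val.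
  have -> : \sum_i dx i (dx i u) z = \sum_j uxx j z.
    apply: eq_bigr => j _.
    rewrite {1}/dx (near_eq_derive _ (g := ux j)); last by apply: filterS near_inn => w /dxu.
    by have H := (Huxx j).2 z (inn z zb); rewrite -/(axis j) derive_val.
  rewrite dtu; last exact: inn.
  by rewrite /cl /q clamp_id// (ltW z1) (ltW zb').
have u_supp (z : R * 'rV[R]_n) : 1 <= z.1 <= b -> r + A k z.1 <= enorm z.2 -> cl u z = 0.
  move=> /[dup] zb /andP[z1 zb'] zr; rewrite /cl clamp_id//.
  apply/eqP/negPn/negP => uz.
  have zT : (z.1%:E < T)%E by apply: le_lt_trans bT; rewrite lee_fin.
  have : eball (r + A k z.1) z.2.
    apply: (usupp z.1 z1 zT); apply: subset_closure => /=.
    by rewrite -surjective_pairing.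
  by rewrite /eball/= ltNge zr.
have ut1 x : cl ut (1, x) = eps * g x.
  have cE (h s : R) : (h + (1 + s), x) = h *: ((1, 0) : R * 'rV[R]_n) + (1 + s, x).
    by congr (_, _) => /=; [rewrite /GRing.scale/= mulr1|rewrite scaler0 add0r].
  have cline : continuous (fun s : R => ((1 + s, x) : R * 'rV[R]_n)).
    apply: cont_pair; last exact: cont_cst.
    by apply: cont_add; [exact: cont_cst|exact: cont_id].
  rewrite -[in LHS](addr0 1).
  apply: (@right_derivative_limit R (fun s => cl u (1 + s, x)) (fun s => cl ut (1 + s, x)) (b - 1)).
  - by rewrite subr_gt0.
  - exact: (cont_comp cline (cont_clamped b1 bT cu)).
  - exact: (cont_comp cline (cont_clamped b1 bT cut)).
  - move=> s /andP[s0 sb].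
    apply: (@is_derive_line R _ (cl u) (fun s => (1 + s, x)) ((1, 0) : R * 'rV[R]_n)).
      by move=> h; rewrite -cE; congr (_, _); rewrite addrCA.
    by have H := clamped_derivative bT dut; apply: (H (1 + s, x)) => /=; lra.
  - apply: cvg_trans (inidt x).
    apply: near_eq_cvg; near=> h; rewrite /cl !clamp_id ?addr0//=.
      by rewrite lexx ltW.
    rewrite lerDl ltW//= -lerBrDl ltW//; near: h.
    by apply: nbhs_right_lt; rewrite subr_gt0.
have U1 : exp_moment L i0 x0 (cl u) 1 = 0.
  apply: (@int_list0 _ _ L L0 [set z | z.1 = 1]) => // -[t x] /= ->.
  by rewrite /cl clamp_id/= ?lexx ?ltW// ini f0 mul0r.
have V1 : exp_moment L i0 x0 (cl ut) 1 = eps * exp_moment L i0 x0 (fun z => g z.2) 1.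
  rewrite /exp_moment -int_listZ//; last first.
    apply: cont_mul; last exact: cont_exp_weight.
    by apply: (cont_comp _ cg); exact/cont_snd/cont_id.
  apply: (@eq_int_list _ _ L [set z | z.1 = 1]) => // -[t x] /= ->.
  by rewrite ut1 mulrA.
have I0 := exp_moment_gt0 i0 r0 cg g0 x0r gx0.
have IL : exp_moment r i0 x0 (fun z => g z.2) 1 <= exp_moment L i0 x0 (fun z => g z.2) 1.
  apply: le_int_list_widen => //; first by rewrite /L -addrA lerDl addr_ge0.
    apply: cont_mul; last exact: cont_exp_weight.
    by apply: (cont_comp _ cg); exact/cont_snd/cont_id.
  by move=> w; rewrite mulr_ge0 ?expR_ge0.
have IL0 := lt_le_trans I0 IL.
have := @moment_bound R n k p r b L i0 x0 (cl u) (cl ut) (cl utt) q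
  (fun j => cl (ux j)) (fun j => cl (uxx j)) k0 k1 p1 r0 b1 bL.
move=> /(_ (cont_clamped b1 bT cu) (cont_clamped b1 bT cut) (cont_clamped b1 bT cutt) cq).
move=> /(_ (fun j => cont_clamped b1 bT (Hux j).1.1) (fun j => cont_clamped b1 bT (Huxx j).1.1)).
move=> /(_ (clamped_derivative bT dut) (clamped_derivative bT dutt)).
move=> /(_ (fun j => clamped_derivative bT (Hux j).2) (fun j => clamped_derivative bT (Huxx j).2)).
have qE (z : R * 'rV[R]_n) : 1 < z.1 < b -> q z = z.1 `^ (- (2 * k)).
  by move=> /andP[z1 zb]; rewrite /q clamp_id// !ltW.
move=> /(_ qE wave u_supp P dP U1).
rewrite V1 mulr_gt0// => /(_ isT) H; apply: le_trans H _.
apply: powR_antimono => //; first exact: mulr_gt0.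
by apply: ler_wpM2l => //; exact: ltW.
Unshelve. all: by end_near. Qed.

Lemma le_ereal_sup_real {R : realType} (T : \bar R) (B : R) : (1%:E < T)%E ->
  (forall b : R, 1 < b -> (b%:E < T)%E -> b <= B) -> (T <= B%:E)%E.
Proof.
move=> T1 H; pose M := Num.max 1 B.
have M1 : 1 <= M by rewrite le_max lexx.
have MB : B <= M by rewrite le_max lexx orbT.
case: T T1 H => [T| |] // T1 H; last first.
  have M2 : 1 < M + 1 by lra.
  by have h := H _ M2 (ltry _); exfalso; lra.
rewrite lte_fin in T1; rewrite lee_fin leNgt; apply/negP => BT.
have MT : M < T by rewrite gt_max T1.
have M2 : 1 < (M + T) / 2 by lra.
have MT2 : (((M + T) / 2)%:E < T%:E)%E by rewrite lte_fin; lra.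
by have h := H _ M2 MT2; exfalso; lra.
Qed.

Theorem theorem1p2 (R : realType) (n : nat) (k p r : R)
    (u0 u1 : 'rV[R]_n -> R)
    (hn : (1 <= n)%N) (hk0 : 0 < k) (hk1 : k < 1)
    (hu0 : forall x, u0 x = 0)
    (hu1C : Cj_compact 1 u1)
    (hu1pos : forall x, 0 <= u1 x)
    (* for u1 = 0 the function u = 0 is a global solution *)
    (hu1nz : exists x, u1 x != 0)
    (hr : 0 < r)
    (hu1supp : supp u1 `<=` eball r)
    (hp1 : 1 < p)
    (hp : (p%:E <= pGla ((1 - k) * n%:R + 2 * k))%E) :
  exists eps0 C : R, 0 < eps0 /\ 0 < C /\
    forall eps : R, 0 < eps -> eps <= eps0 ->
    forall (T : \bar R) (u : R * 'rV[R]_n -> R),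
      has_lifespan k p (fun x => eps * u0 x) (fun x => eps * u1 x) T u ->
      (forall t : R, 1 <= t -> (t%:E < T)%E ->
        supp (fun x : 'rV[R]_n => u (t, x)) `<=` eball (r + A k t)) ->
      (T < +oo)%E /\
      ((p%:E < pGla ((1 - k) * n%:R + 2 * k))%E ->
        (T <= (C * eps `^ (- (1 / (p - 1)
                 - ((1 - k) * n%:R + 2 * k - 1) / 2)^-1))%:E)%E) /\
      (p%:E = pGla ((1 - k) * n%:R + 2 * k) ->
        (T <= (expR (C * eps `^ (- (p - 1))))%:E)%E).
Proof.
set m := (1 - k) * n%:R + 2 * k in hp *.
have m1 : 1 < m.
  have : (1 - k) * 1 <= (1 - k) * n%:R :> R by rewrite ler_wpM2l ?subr_ge0 ?ler1n// ltW.
  by rewrite /m mulr1 => h; apply: lt_le_trans (_ : 1 - k + 2 * k <= _); [lra|rewrite lerD2r].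
have pm : pGla m = ((m + 1) / (m - 1))%:E by rewrite /pGla m1.
have m10 : 0 < m - 1 by rewrite subr_gt0.
have p10 : 0 < p - 1 by rewrite subr_gt0.
pose a := (p - 1) * (m - 1) / 2.
have aE : (p - 1) * (k / 2 + majorant_exp k n) = a.
  by rewrite /a /majorant_exp /m; field.
(* Up to the positive factor m - 1 this compares p with the Glassey exponent. *)
have aP : (1 - a) * 2 = ((m + 1) / (m - 1) - p) * (m - 1).
  by rewrite /a; field; rewrite gt_eqF.
have [x0 hx0] := hu1nz; pose i0 := Ordinal hn.
have cu1 : continuous u1.
  have [[c1 _] _] := hu1C.
  by apply: (@cont_comp_within _ _ _ setT (fun x => x) u1) => //; exact: cont_id.
have x0r : enorm x0 < r by apply: hu1supp; exact: subset_closure.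
have gx0 : 0 < u1 x0 by rewrite lt_neqAle eq_sym hx0 hu1pos.
pose I0 := exp_moment r i0 x0 (fun z => u1 z.2) 1.
have I0_gt0 : 0 < I0 by exact: exp_moment_gt0.
pose c := (p - 1) * (majorant_const k r i0 `^ (1 - p) / 2 `^ p).
have c_gt0 : 0 < c by rewrite mulr_gt0// divr_gt0 ?powR_gt0 ?majorant_const_gt0.
pose G := I0 `^ (1 - p) / c.
have G_gt0 : 0 < G by rewrite divr_gt0 ?powR_gt0.
have key eps T u P b : 0 < eps ->
    has_lifespan k p (fun x => eps * u0 x) (fun x => eps * u1 x) T u ->
    (forall t : R, 1 <= t -> (t%:E < T)%E ->
        supp (fun x : 'rV[R]_n => u (t, x)) `<=` eball (r + A k t)) ->
    (forall t : R, 1 <= t -> is_derive t 1 P (t `^ (- a))) ->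
    1 < b -> (b%:E < T)%E -> P b - P 1 <= G * eps `^ (- (p - 1)).
  move=> eps0 [usol _] usupp dP b1 bT; rewrite -aE in dP.
  have := @lifespan_inequality R n k p r eps b T i0 x0 _ u1 u P hk0 hk1 hp1 hr eps0
    b1 bT _ cu1 hu1pos x0r gx0 usol usupp dP.
  rewrite -/I0 -/c => /(_ _) h.
  have {}h : c * (P b - P 1) <= (eps * I0) `^ (1 - p).
    by apply: h => x; rewrite hu0 mulr0.
  rewrite powRM ?(ltW eps0) ?(ltW I0_gt0)// mulrC -ler_pdivlMr// in h.
  by rewrite opprB [leRHS](_ : _ = eps `^ (1 - p) * I0 `^ (1 - p) / c)// /G mulrAC (mulrC (I0 `^ _)).
have [a1|a1] := ltP a 1.
  have a10 : 0 < 1 - a by rewrite subr_gt0.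
  have pneq : p%:E <> pGla m.
    by rewrite pm => -[E]; move: aP; rewrite -E subrr mul0r; lra.
  pose C := (1 + (1 - a) * G) `^ (1 - a)^-1.
  have C1 : 0 < 1 + (1 - a) * G by rewrite addr_gt0// mulr_gt0.
  exists 1, C; split => //; split; first exact: powR_gt0.
  move=> eps eps0 eps1 T u hu usupp.
  have T1 : (1%:E < T)%E by case: hu => -[].
  suff TB : (T <= (C * eps `^ (- (1 / (p - 1) - (m - 1) / 2)^-1))%:E)%E.
    split; last by split.
    by apply: le_lt_trans TB _; rewrite ltry.
  apply: le_ereal_sup_real => // b b1 bT.
  have := key eps T u _ b eps0 hu usupp
    (fun t t1 => der_powR_primitive a1 (lt_le_trans ltr01 t1)) b1 bT.
  rewrite powR1 -mulrBl ler_pdivrMr// => Hb.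
  set e := eps `^ (- (p - 1)) in Hb.
  (* Since eps <= 1, the value of the primitive at t = 1 is absorbed by e. *)
  have e1 : 1 <= e.
    rewrite /e powRN invf_ge1 ?powR_gt0//.
    rewrite -[leRHS](_ : 1 `^ (p - 1) = 1); last by rewrite powR1.
    by rewrite ge0_ler_powR ?nnegrE// ltW.
  have bE : b `^ (1 - a) <= (1 + (1 - a) * G) * e.
    rewrite mulrDl mul1r; move: Hb; rewrite mulrAC (mulrC G); lra.
  have b0 : 0 < b by lra.
  have e0 : 0 < e by lra.
  have -> : b = (b `^ (1 - a)) `^ (1 - a)^-1.
    by rewrite -powRrM mulfV ?gt_eqF// powRr1 ?ltW.
  have -> : eps `^ (- (1 / (p - 1) - (m - 1) / 2)^-1) = e `^ (1 - a)^-1.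
    rewrite /e -powRrM; congr powR.
    have -> : 1 / (p - 1) - (m - 1) / 2 = (1 - a) / (p - 1).
      by rewrite /a; field; rewrite gt_eqF.
    by rewrite invf_div mulNr.
  rewrite -powRM ?(ltW C1) ?(ltW e0)//.
  by rewrite ge0_ler_powR ?nnegrE ?powR_ge0 ?invr_ge0 ?(ltW a10)// mulr_ge0 ?ltW.
have pge : (m + 1) / (m - 1) <= p.
  rewrite -subr_le0 -(pmulr_lle0 _ m10) -aP; lra.
have pE : p = (m + 1) / (m - 1).
  by apply/eqP; rewrite eq_le pge andbT -lee_fin -pm.
have aE1 : a = 1.
  by move: aP; rewrite -pE subrr mul0r; lra.
exists 1, G; split => //; split => //.
move=> eps eps0 eps1 T u hu usupp.
have T1 : (1%:E < T)%E by case: hu => -[].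
have TB : (T <= (expR (G * eps `^ (- (p - 1))))%:E)%E.
  apply: le_ereal_sup_real => // b b1 bT.
  have b0 : 0 < b by lra.
  have dln (t : R) : 1 <= t -> is_derive t 1 (@ln R) (t `^ (- a)).
    move=> t1; have t0 : 0 < t by lra.
    by rewrite aE1 powR_inv1 ?ltW//; exact: is_derive1_ln.
  have := key eps T u _ b eps0 hu usupp dln b1 bT.
  by rewrite ln1 subr0 => h; rewrite -[leLHS]lnK ?posrE// ler_expR.
split; first by apply: le_lt_trans TB _; rewrite ltry.
split=> //; rewrite pm lte_fin -pE ltxx; by [].
Qed.
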